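(* Let $R_m, R_{m-1},\dots,R_0$ be any folding sequence of labeled roses for $\mathbb{F}_n$, and let $\alpha$ be any loop (nontrivial conjugacy class in $\mathbb{F}_n$). Then $$m\ \ge\ \mathrm{tw}_\alpha(R_0,R_m).$$ Further, if $L>50$ and $\ell_{R_i}(\alpha)\ge L$ for every $i\in\{0,\dots,m\}$, then $$m\ \ge\ \mathrm{tw}_\alpha(R_0,R_m)\,\left(\log_5\frac{L}{50}\right).$$
   Context: $\mathbb{F}_n$ is the free group of rank $n$. A labeled rose $R$ is a graph with one vertex and $n$ oriented petals whose labels form a basis of $\mathbb{F}_n$; reversing the orientation of a petal inverts its label ($\overline{s}$ denotes $s^{-1}$). Its universal cover $T$ is the Cayley tree of $\mathbb{F}_n$ for this basis: vertices are $w_T$, $w\in\mathbb{F}_n$, edges are $(w,ws)_T$ from $w_T$ to $(ws)_T$, where $s$ is a petal label, and $\mathbb{F}_n$ acts by left multiplication. Fold: given two distinct (oriented) petals of $R$ labeled $s$ and $t$, $R'=\mathrm{fold}(R,t,s)$ is the labeled rose with the same labels as $R$ except that $t$ is replaced by $\overline{s}t$. A folding sequence $R_m,\dots,R_0$ is a sequence of labeled roses in which $R_i$ is obtained from $R_{i+1}$ by a fold, for each $0\le i<m$. Loops and lengths: a loop $\alpha$ is the conjugacy class of a nontrivial $w\in\mathbb{F}_n$. $\ell_R(\alpha)=\ell_T(\alpha)$ is the number of edges of the shortest immersed loop in $R$ representing $\alpha$, i.e. the translation length of any $w\in\alpha$ on $T$. $\mathrm{axis}_T(w)$ is the axis of $w$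 in $T$. Partitions and slices: geodesic rays in $T$ from a base vertex are identified with points of the Gromov boundary $\partial\mathbb{F}_n$. For an oriented edge $e$ of $T$, $\partial^+(e)$ (resp. $\partial^-(e)$) is the set of rays eventually lying in front of $e$ (in the component of $T$ minus the interior of $e$ containing the terminal vertex of $e$) (resp. behind $e$, in the component containing the initial vertex). For trees $T_1,T_2$ and edges $e_1$ of $T_1$, $e_2$ of $T_2$, $e_1\times e_2$ is an intersection square if all four sets $\partial^{\pm}(e_1)\cap\partial^{\pm}(e_2)\subset\partial\mathbb{F}_n$ are nonempty. The slice $C_{e_2}(T_1)$ is the (finite) subtree of $T_1$ consisting of the edges $e$ such that $e\times e_2$ is an intersection square. Relative twisting: for roses $R,R'$ with universal covers $T,T'$, $$\mathrm{twist}_\alpha(R,R')=\max_{e'\in T',\ w\in\alpha}\frac{|\mathrm{axis}_T(w)\cap C_{e'}(T)|}{\ell_T(\alpha)},$$ where $e'$ ranges over edges of $T'$ and $|\cdot|$ is the number of edges; $\mathrm{tw}_\alpha(R,R')$ is the integer part of $\mathrm{twist}_\alpha(R,R')$. *)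

(* Defs.v *)
From HB Require Import structures.
From mathcomp Require Import all_boot all_order all_algebra.
From mathcomp Require Import finmap.
From mathcomp Require Import all_classical all_reals all_analysis.

Set Implicit Arguments.
Unset Strict Implicit.
Unset Printing Implicit Defensive.

Import Order.TTheory GRing.Theory Num.Theory.

Local Open Scope fset_scope.
Local Open Scope classical_set_scope.

(* Minimum of a nonempty set of natural numbers (0 if the set is empty). *)
Definition nat_min (A : set nat) : nat :=
  xget 0%N [set k | A k /\ forall j, A j -> (k <= j)%N].

Section FreeGroup.
Variables (n : nat) (F : groupType).

(* A letter (i, e) stands for b_i if e = false and for b_i^-1 if e = true. *)
Definition letter_val (b : 'I_n -> F) (p : 'I_n * bool) : F :=
  if p.2 then ((b p.1)^-1)%g else b p.1.

Definition reduced (u : seq ('I_n * bool)) : bool :=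
  sorted (fun p q => q != (p.1, ~~ p.2)) u.

Definition word_val (b : 'I_n -> F) (u : seq ('I_n * bool)) : F :=
  (\prod_(p <- u) letter_val b p)%g.

Definition is_basis (b : 'I_n -> F) : Prop :=
  forall x : F, exists! u, reduced u /\ word_val b u = x.

Definition free_of_rank : Prop := exists b : 'I_n -> F, is_basis b.

(* The petals carry a reference orientation: [rose_label R i] is the label of
   the i-th petal so oriented, and [petal_label R p] below is the label of an
   arbitrary oriented petal p = (i, e), with e = true for the reverse
   orientation. *)
Record labeled_rose := LabeledRose {
  rose_label :> 'I_n -> F;
  _ : is_basis rose_label
}.

Definition petal_label (R : labeled_rose) (p : 'I_n * bool) : F :=
  letter_val R p.

(* R' = fold(R, t, s) where s, t are the labels of the oriented petals p, q. *)
Definition is_fold_along (R R' : labeled_rose) (p q : 'I_n * bool) : Prop :=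
  p.1 != q.1 /\
  petal_label R' q = ((petal_label R p)^-1 * petal_label R q)%g /\
  forall k, k != q.1 -> R' k = R k.

Definition is_fold (R R' : labeled_rose) : Prop :=
  exists p q, is_fold_along R R' p q.

(* The sequence R_m, ..., R_0; the values Rs i for i > m are irrelevant. *)
Definition folding_sequence (m : nat) (Rs : nat -> labeled_rose) : Prop :=
  forall i, (i < m)%N -> is_fold (Rs i.+1) (Rs i).

(* The universal cover T of R, as the Cayley tree: its vertices are the
   elements of F. *)
Definition tree_adj (R : labeled_rose) : rel F :=
  fun x y => [exists p, y == (x * petal_label R p)%g].

Definition tree_dist (R : labeled_rose) (x y : F) : nat :=
  nat_min [set k | exists p : seq F,
    [/\ path (tree_adj R) x p, last x p = y & size p = k]].

(* (w, i) is the edge of T from w to w b_i; every unoriented edge of T has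
   exactly one such presentation, so sets of edges are counted correctly.
   Reversing the orientation of an edge exchanges its two sides, which is
   immaterial for intersection squares. *)
Definition edge : Type := (F * 'I_n)%type.

Definition edge_org (e : edge) : F := e.1.
Definition edge_trm (R : labeled_rose) (e : edge) : F := (e.1 * R e.2)%g.

(* Adjacency in T minus the interior of e. *)
Definition tree_adj_off (R : labeled_rose) (e : edge) : rel F :=
  fun x y => [&& tree_adj R x y,
    (x, y) != (edge_org e, edge_trm R e) &
    (x, y) != (edge_trm R e, edge_org e)].

Definition component_off (R : labeled_rose) (e : edge) (x : F) : set F :=
  [set v | exists p : seq F, path (tree_adj_off R e) x p /\ last x p = v].

Definition in_front (R : labeled_rose) (e : edge) : set F :=
  component_off R e (edge_trm R e).

Definition behind (R : labeled_rose) (e : edge) : set F :=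
  component_off R e (edge_org e).

Definition is_ray (R : labeled_rose) (r : nat -> F) : Prop :=
  r 0%N = 1%g /\
  forall i j, (i <= j)%N -> tree_dist R (r i) (r j) = (j - i)%N.

(* Finite Hausdorff distance for the word metric |x^-1 y| of a finite
   generating set; as word-metric balls are finite, this is independent of
   that set, so that rays of different Cayley trees of F can be compared. *)
Definition asymptotic (r r' : nat -> F) : Prop :=
  exists S : seq F,
    (forall i, exists j, ((r i)^-1 * r' j)%g \in S) /\
    (forall j, exists i, ((r i)^-1 * r' j)%g \in S).

(* A point of the Gromov boundary of F is the class of a ray of a Cayley
   tree. *)
Definition bdry_point (r : nat -> F) : set (nat -> F) :=
  [set r' | asymptotic r r'].

Definition bdry_eventually (R : labeled_rose) (V : set F) :
    set (set (nat -> F)) :=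
  [set bdry_point r | r in
    [set r | is_ray R r /\ exists N, forall k, (N <= k)%N -> V (r k)]].

Definition bdry_plus (R : labeled_rose) (e : edge) : set (set (nat -> F)) :=
  bdry_eventually R (in_front R e).

Definition bdry_minus (R : labeled_rose) (e : edge) : set (set (nat -> F)) :=
  bdry_eventually R (behind R e).

Definition intersection_square (R1 R2 : labeled_rose) (e1 e2 : edge) : Prop :=
  [/\ (bdry_plus R1 e1 `&` bdry_plus R2 e2) !=set0,
      (bdry_plus R1 e1 `&` bdry_minus R2 e2) !=set0,
      (bdry_minus R1 e1 `&` bdry_plus R2 e2) !=set0 &
      (bdry_minus R1 e1 `&` bdry_minus R2 e2) !=set0].

(* The slice C_{e2}(T1), as a set of edges of T1. *)
Definition slice (R1 R2 : labeled_rose) (e2 : edge) : set edge :=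
  [set e1 | intersection_square R1 R2 e1 e2].

Definition is_loop (alpha : set F) : Prop :=
  exists2 w : F, w <> 1%g & alpha = [set (w ^ g)%g | g in [set: F]].

Definition translation_length (R : labeled_rose) (w : F) : nat :=
  nat_min [set tree_dist R v (w * v)%g | v in [set: F]].

(* All the elements of a loop have the same translation length. *)
Definition loop_length (R : labeled_rose) (alpha : set F) : nat :=
  nat_min [set translation_length R w | w in alpha].

(* The axis of w is its minimal displacement set; it is given by its edges. *)
Definition on_axis (R : labeled_rose) (w v : F) : Prop :=
  tree_dist R v (w * v)%g = translation_length R w.

Definition axis (R : labeled_rose) (w : F) : set edge :=
  [set e | on_axis R w (edge_org e) /\ on_axis R w (edge_trm R e)].

(* Slices are finite, so that [fset_set] yields the true number of edges.
   There are finitely many orbits of pairs (e', axis of w) giving a nonzero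
   ratio, so that the supremum is a maximum. *)
Definition twist (K : realType) (alpha : set F) (R R' : labeled_rose) : K :=
  sup [set x : K | exists (e' : edge) (w : F), alpha w /\
    x = ((#|` fset_set (axis R w `&` slice R R' e')|)%:R
         / (loop_length R alpha)%:R)%R].

Definition tw (K : realType) (alpha : set F) (R R' : labeled_rose) : int :=
  Num.floor (twist K alpha R R').

End FreeGroup.

Definition log5 (K : realType) (x : K) : K := (ln x / ln 5)%R.

(* Main.v *)
Require Import Defs.
From mathcomp Require Import all_boot all_order all_algebra.
From mathcomp Require Import all_classical all_reals all_analysis.
From mathcomp Require Import zify lra finmap.

(** All the universal covers have the same vertex set, the free group itself, so
    that a geodesic from [X] to [Y] in the cover of [R] is nothing but the
    reduced word of [X^-1 Y] in the labels of [R], and distances are lengths of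
    reduced words.

    Write [T_i] for the cover of [R_i].  Suppose that the axis of [w] in [T_0]
    shares at least [k l] edges with the slice over an edge [e'] of [T_m], where
    [l] is the length of the loop.  The first and the last of these edges both
    form a square with [e'], which gives points [X], [X'] behind the first one
    and points [Y], [Y'] in front of the last one such that [e'] separates [X]
    and [Y] from [X'] and [Y'] ([intersection_square_points]).  In [T_0] the
    geodesics [[X, Y]] and [[X', Y']] run together along [k] full periods of the
    axis of [w] ([square_overlap]); in [T_m] they are disjoint, as they lie on
    different sides of [e'] ([separated_no_overlap]).  So it is enough to bound
    the number of common periods that can be lost in passing from [T_i] to
    [T_(i+1)].

    Undoing a fold rewrites words by [q -> p^-1 q].  The only cancellations are
    [p (p^-1 q) = q] and its inverse; they involve two adjacent letters and
    never interact ([unfold_word_reduced]), so a reduced word can be cut into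
    pieces that are rewritten independently, provided that no cut separates two
    cancelling letters ([unfold_word_cat]).  Hence a point of a geodesic of
    [T_i] is within one edge of the geodesic of [T_(i+1)] with the same ends.
    There are two ways to exploit this.

    First, one step costs at most one period ([fold_overlap]): if the two ends
    of the periodic stretch were both spoilt, its period would fail to be
    cyclically reduced or would cancel against itself, and in the latter case
    shifting the base point by one letter loses nothing.  As no overlap is left
    in [T_m], [k < m] for a positive [k], which is the first inequality.

    Second, forget the periods and only follow the two ends of the common
    stretch.  The distance by which they have drifted is at most doubled and
    increased by one in each step ([fold_near]), so it is at most [2^j - 1]
    after [j] steps.  As long as twice this distance does not exceed the length
    of the loop, restoring the periodic description costs a single period
    ([near_overlap]).  So [p] steps cost at most one period as soon as
    [2 (2^p - 1) <= L], and [k p <= m] ([overlap_mul_le]).  When [L > 50] this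
    allows [p] to be the least integer greater than [log_5 (L / 50)]. *)

Set Implicit Arguments.
Unset Strict Implicit.
Unset Printing Implicit Defensive.

Import Order.TTheory GRing.Theory Num.Theory.

(** * Reduced words and half-trees *)

Section Words.
Variables (n : nat) (F : groupType).
Implicit Types (b : 'I_n -> F) (R : labeled_rose n F) (x y : 'I_n * bool)
  (u v c : seq ('I_n * bool)) (g h a : F).

Definition inv_letter x : 'I_n * bool := (x.1, ~~ x.2).

Lemma inv_letterK : involutive inv_letter.
Proof. by case=> i e; rewrite /inv_letter /= negbK. Qed.

Lemma inv_letter_neq x : inv_letter x != x.
Proof. by case: x => i e; rewrite xpair_eqE /= eqxx; case: e. Qed.

Lemma eq_inv_letter x y : (inv_letter x == y) = (x == inv_letter y).
Proof. by rewrite (inv_eq inv_letterK). Qed.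

(** The relation whose [sorted] words are the reduced ones; having it as a named
    relation gives access to the lemmas on [sorted] and [cycle]. *)
Definition compat x y := y != inv_letter x.

Lemma reducedE u : reduced u = sorted compat u.
Proof. by []. Qed.

Lemma compat_inv x y : compat (inv_letter y) (inv_letter x) = compat x y.
Proof. by rewrite /compat inv_letterK eq_sym. Qed.

Definition inv_word u := rev (map inv_letter u).

Lemma inv_wordK : involutive inv_word.
Proof.
move=> u; rewrite /inv_word map_rev revK -map_comp.
by rewrite (eq_map (g := id)) ?map_id // => x; exact: inv_letterK.
Qed.

Lemma inv_word_cons x u : inv_word (x :: u) = rcons (inv_word u) (inv_letter x).
Proof. by rewrite /inv_word /= rev_cons. Qed.

Lemma inv_word_cat u v : inv_word (u ++ v) = inv_word v ++ inv_word u.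
Proof. by rewrite /inv_word map_cat rev_cat. Qed.

Lemma size_inv_word u : size (inv_word u) = size u.
Proof. by rewrite size_rev size_map. Qed.

Lemma reduced_inv u : reduced (inv_word u) = reduced u.
Proof.
rewrite !reducedE /inv_word rev_sorted sorted_map.
by apply: eq_sorted => x y; exact: compat_inv.
Qed.

Lemma reduced_cat u v :
  reduced (u ++ v) = [&& reduced u, reduced v &
    (if u is x :: u' then if v is y :: _ then compat (last x u') y else true
     else true)].
Proof.
rewrite !reducedE; case: u => [|x u]; first by rewrite andbT.
case: v => [|y v]; first by rewrite cats0 /= !andbT.
by rewrite /= cat_path /= [compat _ _ && _]andbC.
Qed.

Lemma reduced_catl u v : reduced (u ++ v) -> reduced u.
Proof. by rewrite reduced_cat => /and3P[]. Qed.

Lemma reduced_catr u v : reduced (u ++ v) -> reduced v.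
Proof. by rewrite reduced_cat => /and3P[]. Qed.

Lemma reduced_cat_rcons_cons u x y v :
  reduced (rcons u x ++ y :: v) =
  [&& reduced (rcons u x), reduced (y :: v) & compat x y].
Proof.
rewrite reduced_cat; case: u => [|z u] //=.
by rewrite last_rcons.
Qed.

(** Reducedness only concerns adjacent letters, all of which are seen by one of
    the two overlapping words. *)
Lemma reduced_glue u v w :
  v != [::] -> reduced (u ++ v) -> reduced (v ++ w) -> reduced (u ++ v ++ w).
Proof.
case: v => // x v _ h1 h2; rewrite reduced_cat h2 (reduced_catl h1) /=.
by case: u h1 => // y u; rewrite reduced_cat => /and3P[].
Qed.

Lemma word_val_nil b : word_val b [::] = 1%g.
Proof. by rewrite /word_val big_nil. Qed.

Lemma word_val_cons b x u : word_val b (x :: u) = (letter_val b x * word_val b u)%g.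
Proof. by rewrite /word_val big_cons. Qed.

Lemma word_val_cat b u v : word_val b (u ++ v) = (word_val b u * word_val b v)%g.
Proof. by rewrite /word_val big_cat. Qed.

Lemma word_val1 b x : word_val b [:: x] = letter_val b x.
Proof. by rewrite word_val_cons word_val_nil mulg1. Qed.

Lemma word_val_rcons b u x :
  word_val b (rcons u x) = (word_val b u * letter_val b x)%g.
Proof. by rewrite -cats1 word_val_cat word_val1. Qed.

Lemma letter_val_inv b x : letter_val b (inv_letter x) = (letter_val b x)^-1%g.
Proof. by case: x => i []; rewrite /letter_val /= ?invgK. Qed.

Lemma word_val_inv b u : word_val b (inv_word u) = (word_val b u)^-1%g.
Proof.
elim: u => [|x u IH]; first by rewrite /inv_word /= word_val_nil invg1.
by rewrite inv_word_cons word_val_rcons IH letter_val_inv word_val_cons invgM.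
Qed.

Lemma rose_basis R : is_basis R.
Proof. by case: R. Qed.

Definition rword R g : seq ('I_n * bool) := xget [::] [set u | reduced u /\ word_val R u = g].

Lemma rwordP R g : reduced (rword R g) /\ word_val R (rword R g) = g.
Proof.
have [u [hu _]] := rose_basis R g.
exact: (@xgetPex _ [::] [set u | reduced u /\ word_val R u = g] (ex_intro _ u hu)).
Qed.

Lemma rword_reduced R g : reduced (rword R g).
Proof. by have [] := rwordP R g. Qed.

Lemma rword_val R g : word_val R (rword R g) = g.
Proof. by have [] := rwordP R g. Qed.

Lemma rword_uniq R u : reduced u -> rword R (word_val R u) = u.
Proof.
move=> ru; have [v [_ hv]] := rose_basis R (word_val R u).
by rewrite -(hv (rword R (word_val R u))) ?(hv u) //; exact: rwordP.
Qed.

Lemma rword_eq R u g : reduced u -> word_val R u = g -> rword R g = u.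
Proof. by move=> ru <-; exact: rword_uniq. Qed.

Lemma rword1 R : rword R 1%g = [::].
Proof. by apply: rword_eq => //; exact: word_val_nil. Qed.

Lemma rword_inv R g : rword R g^-1%g = inv_word (rword R g).
Proof.
by apply: rword_eq; rewrite ?reduced_inv ?rword_reduced // word_val_inv rword_val.
Qed.

(** Appending a letter to a reduced word leaves it reduced unless it is the inverse
    of the last letter. *)
Lemma rword_mul_letter R g x :
  (rword R (g * letter_val R x)%g = rcons (rword R g) x) \/
  (rword R g = rcons (rword R (g * letter_val R x)%g) (inv_letter x)).
Proof.
have := rword_reduced R g; have := rword_val R g.
case/lastP: (rword R g) => [|u y] hv hr.
  by left; apply: rword_eq => //; rewrite word_val_rcons hv.
have [yx|yx] := eqVneq y (inv_letter x); [right|left].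
  rewrite yx in hv hr *; congr rcons.
  apply/esym/rword_eq; first by move: hr; rewrite -cats1; exact: reduced_catl.
  by rewrite -hv word_val_rcons letter_val_inv mulgVK.
apply: rword_eq; last by rewrite word_val_rcons hv.
rewrite -[rcons (rcons _ _) _]cats1 reduced_cat_rcons_cons hr /=.
by rewrite /compat -eq_inv_letter eq_sym.
Qed.

Lemma size_rword_mul_letter R g x :
  (size (rword R (g * letter_val R x)%g) <= (size (rword R g)).+1)%N.
Proof.
have [->|->] := rword_mul_letter R g x; first by rewrite size_rcons.
by rewrite size_rcons -addn2 leq_addr.
Qed.

Lemma size_rword_le R u : (size (rword R (word_val R u)) <= size u)%N.
Proof.
elim/last_ind: u => [|u x IH]; first by rewrite word_val_nil rword1.
rewrite word_val_rcons size_rcons.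
exact: leq_trans (size_rword_mul_letter R _ x) _.
Qed.

Lemma size_rwordV R g : size (rword R g^-1%g) = size (rword R g).
Proof. by rewrite rword_inv size_inv_word. Qed.

Lemma size_rwordM R g h :
  (size (rword R (g * h)%g) <= size (rword R g) + size (rword R h))%N.
Proof.
rewrite -{1}(rword_val R g) -{1}(rword_val R h) -word_val_cat -size_cat.
exact: size_rword_le.
Qed.

(** The half-tree in front of the oriented edge from [g] with label [x]: the
    geodesic from [g] to [h] leaves [g] through that edge. *)
Definition side R g x h : bool := ohead (rword R (g^-1 * h)%g) == Some x.

(** Reversing an edge exchanges its two half-trees, since exactly one of the
    geodesics from its two ends to [h] crosses it. *)
Lemma side_flip R g x h :
  side R (g * letter_val R x)%g (inv_letter x) h = ~~ side R g x h.
Proof.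
rewrite /side invgM -letter_val_inv -mulgA.
set k := (g^-1 * h)%g.
have := rword_reduced R k; have := rword_val R k.
case: (rword R k) => [|y u] /= hv hr.
  by rewrite -hv word_val_nil mulg1 -(word_val1 R) rword_uniq //= eqxx.
have [yx|yx] := eqVneq y x.
  rewrite yx in hv hr *.
  have ru : reduced u := @reduced_catr [:: x] u hr.
  rewrite -hv word_val_cons letter_val_inv mulKg rword_uniq // eqxx /=.
  case: u hr {hv ru} => //= z u; rewrite /reduced /= => /andP[zx _].
  by apply/negbTE/eqP => -[zx']; rewrite zx' eqxx in zx.
rewrite -hv -word_val_cons rword_uniq /=; last first.
  by move: hr; rewrite /reduced /= negbK -surjective_pairing yx.
by rewrite eqxx; symmetry; apply/eqP => -[yx']; rewrite yx' eqxx in yx.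
Qed.

End Words.

(** * Distances, half-trees and squares in the universal cover *)

Section Trees.
Variables (n : nat) (F : groupType).
Implicit Types (b : 'I_n -> F) (R : labeled_rose n F) (x y : 'I_n * bool)
  (u v c : seq ('I_n * bool)) (g h a o : F).

Lemma nat_minP (A : set nat) k :
  A k -> A (nat_min A) /\ forall j, A j -> (nat_min A <= j)%N.
Proof.
move=> Ak; have exA : exists k, `[< A k >] by exists k; exact/asboolP.
case: (ex_minnP exA) => m /asboolP Am mmin.
rewrite /nat_min; apply: (@xgetPex _ 0%N [set k | A k /\ _]).
by exists m; split=> // j Aj; apply: mmin; exact/asboolP.
Qed.

Lemma nat_min_eq (A : set nat) k :
  A k -> (forall j, A j -> (k <= j)%N) -> nat_min A = k.
Proof.
move=> Ak kmin; have [Am mmin] := nat_minP Ak.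
by apply/eqP; rewrite eqn_leq mmin ?kmin.
Qed.

Lemma tree_adj_path R g p : path (tree_adj R) g p ->
  exists2 u, size u = size p & last g p = (g * word_val R u)%g.
Proof.
elim: p g => [|h p IH] g /=; first by exists [::]; rewrite ?word_val_nil ?mulg1.
case/andP=> /existsP[x /eqP ->] /IH[u su ->].
by exists (x :: u); rewrite /= ?su // word_val_cons mulgA.
Qed.

Lemma path_of_word R g u : exists p,
  [/\ path (tree_adj R) g p, last g p = (g * word_val R u)%g & size p = size u].
Proof.
elim: u g => [|x u IH] g; first by exists [::]; rewrite word_val_nil mulg1.
have [p [pp lp sp]] := IH (g * letter_val R x)%g.
exists ((g * letter_val R x)%g :: p); split=> /=; last by rewrite sp.
- by rewrite pp andbT; apply/existsP; exists x.
- by rewrite lp word_val_cons mulgA.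
Qed.

Lemma tree_distE R g h : tree_dist R g h = size (rword R (g^-1 * h)%g).
Proof.
apply: nat_min_eq => [|j [p [/tree_adj_path[u su ->] lp <-]]].
  have [p [pp lp sp]] := path_of_word R g (rword R (g^-1 * h)%g).
  by exists p; split=> //; rewrite lp rword_val mulVKg.
by rewrite -lp mulKg -su size_rword_le.
Qed.

(** The edge that defines a half-tree is the only one that joins it to its
    complement; all the separation properties below follow from this. *)
Lemma side_cross R o x g y :
  side R o x (g * letter_val R y)%g != side R o x g ->
  (g = o /\ y = x) \/ ((g * letter_val R y)%g = o /\ y = inv_letter x).
Proof.
have k1 h : rword R (o^-1 * h)%g = [::] -> h = o.
  by move=> e; apply/(mulgI o^-1%g); rewrite mulVg -(rword_val R (_ * h)%g) e word_val_nil.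
rewrite /side; have := @rword_mul_letter _ _ R (o^-1 * g)%g y; rewrite -mulgA => -[e|e].
- rewrite e; case E: (rword R (o^-1 * g)%g) => [|z u] /=; last by rewrite eqxx.
  have [->|ne] := eqVneq y x; first by left; rewrite (k1 _ E).
  by have /negbTE -> : Some y != Some x by apply: contra ne => /eqP[->].
- rewrite e; case E: (rword R (o^-1 * _)%g) => [|z u] /=; last by rewrite eqxx.
  rewrite (k1 _ E); have [<-|ne] := eqVneq (inv_letter y) x.
    by right; rewrite inv_letterK.
  by have /negbTE -> : Some (inv_letter y) != Some x by apply: contra ne => /eqP[->].
Qed.

(** A path that changes sides contains the separating edge, crossed in the
    direction that leads out of the side where the path starts. *)
Lemma side_cross_word R o x g u :
  side R o x (g * word_val R u)%g != side R o x g ->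
  exists u1 y u2, u = u1 ++ y :: u2 /\
   if side R o x g then (g * word_val R (rcons u1 y))%g = o /\ y = inv_letter x
   else (g * word_val R u1)%g = o /\ y = x.
Proof.
elim/last_ind: u => [|u y IH]; first by rewrite word_val_nil mulg1 eqxx.
have [e|ne _] := eqVneq (side R o x (g * word_val R u)%g) (side R o x g).
  rewrite word_val_rcons mulgA -e => h; exists u, y, [::]; split; first by rewrite cats1.
  have [[h1 ->]|[h1 h2]] := side_cross h.
    by rewrite {1}/side h1 mulVg rword1.
  case: ifP => [_|s]; first by rewrite word_val_rcons mulgA.
  move: h; rewrite h2 in h1 *; rewrite s {1}/side.
  by rewrite h1 mulVg rword1.
have [u1 [z [u2 [-> h]]]] := IH ne.
by exists u1, z, (rcons u2 y); rewrite rcons_cat.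
Qed.

(** A reduced path that leaves a half-tree and comes back crosses its edge twice
    in opposite directions; the part in between is a closed path, hence empty,
    and the two crossings would cancel. *)
Lemma side_convex_in R o x g u v :
  reduced (u ++ v) -> side R o x g -> side R o x (g * word_val R (u ++ v))%g ->
  side R o x (g * word_val R u)%g.
Proof.
move=> ruv sg sk; apply: contraT => sh.
have [|u1 [y [u2 [eu]]]] := @side_cross_word R o x g u; first by rewrite sg (negbTE sh).
rewrite sg => -[e1 ey].
have [|v1 [z [v2 [ev]]]] := @side_cross_word R o x (g * word_val R u)%g v.
  by rewrite -mulgA -word_val_cat sk (negbTE sh).
rewrite (negbTE sh) => -[e2 ez].
move: e2; rewrite eu -cat_rcons word_val_cat mulgA e1 => e2.
have r1 : reduced (u2 ++ v1).
  move: ruv; rewrite eu ev -cat_rcons -catA => /reduced_catr.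
  by rewrite catA => /reduced_catl.
have : rword R (word_val R (u2 ++ v1)) = [::].
  by rewrite -(rword1 R) word_val_cat -[in RHS](mulVg o) -{2}e2 -mulgA mulKg.
rewrite rword_uniq //; case: (u2) (v1) eu ev => // -[] // eu ev.
move: ruv; rewrite eu ev cats1 reduced_cat_rcons_cons => /and3P[_ _].
by rewrite /compat ey ez inv_letterK eqxx.
Qed.

(** Half-trees are convex, and by [side_flip] so are their complements. *)
Lemma side_convex R o x g u v (s : bool) :
  reduced (u ++ v) -> side R o x g = s ->
  side R o x (g * word_val R (u ++ v))%g = s ->
  side R o x (g * word_val R u)%g = s.
Proof.
case: s => ruv; first exact: side_convex_in.
move=> /negbT; rewrite -side_flip => h1 /negbT; rewrite -side_flip => h2.
by apply/negbTE; rewrite -side_flip; exact: side_convex_in h1 h2.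
Qed.

(** A path that is too short to reach the separating edge stays on its side. *)
Lemma side_far R o x g u : (size u < size (rword R (o^-1 * g)%g))%N ->
  side R o x (g * word_val R u)%g = side R o x g.
Proof.
move=> su; have [//|] := eqVneq (side R o x (g * word_val R u)%g) (side R o x g).
move=> /side_cross_word[u1 [y [u2 [eu h]]]].
have : exists2 w, (size w <= size u)%N & (g * word_val R w)%g = o.
  case: ifP h => _ [h _]; [exists (rcons u1 y)|exists u1] => //.
    by rewrite eu -cat_rcons size_cat leq_addr.
  by rewrite eu size_cat leq_addr.
case=> w sw /(canRL (mulgK _)) eg.
move: su; rewrite eg mulKg -word_val_inv ltnNge.
by rewrite (leq_trans (size_rword_le _ _)) // size_inv_word.
Qed.

Lemma side_adj_off R e g h : tree_adj_off R e g h ->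
  side R e.1 (e.2, false) h = side R e.1 (e.2, false) g.
Proof.
case/and3P=> /existsP[y /eqP ->] ne1 ne2.
set l := LHS; set r := RHS; have [//|] := eqVneq l r; move=> /side_cross.
case=> [[h1 h2]|[h1 h2]].
  by move: ne1; rewrite h1 h2 /edge_org /edge_trm /petal_label /letter_val eqxx.
move: ne2; rewrite /petal_label h1 /edge_org /edge_trm.
by rewrite (canRL (mulgK _) h1) h2 letter_val_inv invgK /letter_val eqxx.
Qed.

Lemma component_off_side R e g h : component_off R e g h ->
  side R e.1 (e.2, false) h = side R e.1 (e.2, false) g.
Proof.
case=> p [+ <-]; elim: p g => //= k p IH g /andP[/side_adj_off <-]; exact: IH.
Qed.

Lemma in_front_side R e h : in_front R e h -> side R e.1 (e.2, false) h.
Proof.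
move=> /component_off_side ->; rewrite /side mulKg.
by rewrite (@rword_eq _ _ R [:: (e.2, false)]) // word_val1.
Qed.

Lemma behind_side R e h : behind R e h -> side R e.1 (e.2, false) h = false.
Proof. by move=> /component_off_side ->; rewrite /side mulVg rword1. Qed.

Lemma ray_size R r j : is_ray R r -> size (rword R (r j)) = j.
Proof. by case=> r0 /(_ 0%N j isT); rewrite tree_distE r0 invg1 mul1g subn0. Qed.

(** Far along the first ray, points are at bounded distance from points of the
    second ray which are far from the edge that is to be compared with, so both
    side conditions hold at once. In this way points of the boundary are replaced
    by elements of the group. *)
Lemma asymptotic_sides R1 R2 r1 r2 o1 x1 o2 x2 (s1 s2 : bool) N1 N2 :
  is_ray R1 r1 -> is_ray R2 r2 -> asymptotic r1 r2 ->
  (forall k, (N1 <= k)%N -> side R1 o1 x1 (r1 k) = s1) ->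
  (forall k, (N2 <= k)%N -> side R2 o2 x2 (r2 k) = s2) ->
  exists g, side R1 o1 x1 g = s1 /\ side R2 o2 x2 g = s2.
Proof.
move=> ray1 ray2 [S [hS _]] h1 h2.
pose D (R : labeled_rose n F) := (\max_(s <- S) size (rword R s))%N.
have hD R s : s \in S -> (size (rword R s) <= D R)%N.
  by move=> sS; rewrite /D; exact: (@leq_bigmax_seq _ S xpredT (fun s => size (rword R s))).
pose J := (N2 + (size (rword R2 o2) + (D R2).+1))%N.
pose M := (\max_(j < J) size (rword R1 (r2 j)))%N.
pose i := (N1 + (M + (D R1)).+1)%N.
have [j jS] := hS i.
have ei : r1 i = (r2 j * ((r1 i)^-1 * r2 j)^-1)%g by rewrite invgM invgK mulVKg.
have Jj : (J <= j)%N.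
  rewrite leqNgt; apply/negP => jJ.
  have := ray_size i ray1; rewrite ei => ei'.
  have : (i <= M + D R1)%N.
    rewrite -{1}ei' (leq_trans (size_rwordM _ _ _)) // leq_add //.
      exact: (@leq_bigmax _ (fun j : 'I_J => size (rword R1 (r2 j))) (Ordinal jJ)).
    by rewrite size_rwordV hD.
    by rewrite /i; lia.
(* The bound [J] absorbs the distance from the identity to [o2] and the distance
   [D R2] between the two rays. *)
exists (r1 i); split; first by apply: h1; exact: leq_addr.
rewrite -(h2 j (leq_trans (leq_addr _ _) Jj)) ei -[X in (r2 j * X)%g](rword_val R2).
apply: side_far; rewrite size_rwordV.
have : (j <= size (rword R2 o2) + size (rword R2 (o2^-1 * r2 j)%g))%N.
  by rewrite -{1}(ray_size j ray2) -{1}(mulVKg o2 (r2 j)) size_rwordM.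
move: Jj (hD R2 _ jS); rewrite /J; lia.
Qed.

(** Squares are used only through these elements, which trade boundary points for
    the ends of finite geodesics. *)
Lemma intersection_square_points R1 R2 (e1 e2 : edge n F) (s1 s2 : bool) :
  intersection_square R1 R2 e1 e2 ->
  exists g, side R1 e1.1 (e1.2, false) g = s1 /\ side R2 e2.1 (e2.2, false) g = s2.
Proof.
have key V1 V2 : 
   (forall h, V1 h -> side R1 e1.1 (e1.2, false) h = s1) ->
   (forall h, V2 h -> side R2 e2.1 (e2.2, false) h = s2) ->
   (bdry_eventually R1 V1 `&` bdry_eventually R2 V2 !=set0)%classic ->
   exists g, side R1 e1.1 (e1.2, false) g = s1 /\ side R2 e2.1 (e2.2, false) g = s2.
  move=> hV1 hV2 [_ [[r1 [ray1 [N1 h1]] <-] [r2 [ray2 [N2 h2]] e]]].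
  apply: (asymptotic_sides ray1 ray2 _ (fun k hk => hV1 _ (h1 k hk)) (fun k hk => hV2 _ (h2 k hk))).
  have : bdry_point r2 r2.
    exists [:: 1%g]; split=> i; exists i; by rewrite mulVg mem_head.
  by rewrite e.
case=> pp pm mp mm; case: s1 s2 key => -[] key.
- by apply: key pp => h; exact: in_front_side.
- by apply: key pm => h; [exact: in_front_side|exact: behind_side].
- by apply: key mp => h; [exact: behind_side|exact: in_front_side].
- by apply: key mm => h; exact: behind_side.
Qed.

End Trees.

(** * Rewriting words along a fold *)

Section Fold.
Variables (n : nat) (F : groupType).
Variables (R R' : labeled_rose n F) (p q : 'I_n * bool).
Hypothesis fold_pq : is_fold_along R R' p q.
Implicit Types (x y : 'I_n * bool) (u v c : seq ('I_n * bool)) (g h a o : F).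
Local Notation inv := (@inv_letter n).

(** The pairs of adjacent letters whose images under [q -> p^-1 q] cancel. *)
Definition cancelling x y := (x == p) && (y == q) || (x == inv q) && (y == inv p).

Definition unfold_pair x := if x == p then q else inv q.

Definition unfold_letter x :=
  if x == q then [:: inv p; q] else if x == inv q then [:: inv q; p] else [:: x].

(** The reduced form of the image of a reduced word under [q -> p^-1 q]. The
    cancelling pairs of a reduced word are disjoint, so that replacing each of them
    by a single letter is unambiguous and no further cancellation occurs. *)
Fixpoint unfold_word u : seq ('I_n * bool) :=
  match u with
  | [::] => [::]
  | x :: u' =>
    match u' with
    | [::] => unfold_letter x
    | y :: v => if cancelling x y then unfold_pair x :: unfold_word v
                else unfold_letter x ++ unfold_word u'
    end
  end.

Definition good_cut u v :=
  if u is x :: u' then if v is y :: _ then ~~ cancelling (last x u') y else true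
  else true.

Lemma fold_neq : [/\ p <> q, p <> inv q, inv p <> q & inv p <> inv q].
Proof.
have [pq _] := fold_pq; rewrite /inv_letter.
by split=> e; move: pq; rewrite ?e -?e ?eqxx //; case: p q e => ? ? [? ?] [-> _]; rewrite eqxx.
Qed.

Lemma letter_val_fold x :
  letter_val R' x = word_val R (unfold_letter x).
Proof.
have [_ [hq hk]] := fold_pq; rewrite /unfold_letter.
have vq : letter_val R' q = ((letter_val R p)^-1 * letter_val R q)%g by [].
have [->|xq] := eqVneq x q.
  by rewrite word_val_cons word_val1 letter_val_inv vq.
have [->|xq'] := eqVneq x (inv q).
  by rewrite letter_val_inv vq invgM invgK word_val_cons word_val1 letter_val_inv.
rewrite word_val1 /letter_val hk //; apply/eqP => e1.
case: x q e1 xq xq' {hq hk vq} => i e [j f] /= -> .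
by rewrite /inv_letter /= !xpair_eqE !eqxx; case: e f => -[].
Qed.

Lemma unfold_word_val u : word_val R (unfold_word u) = word_val R' u.
Proof.
have [k] := ubnP (size u); elim: k u => // k IH [|x [|y v]] /= sk.
- by rewrite !word_val_nil.
- by rewrite word_val1 letter_val_fold.
case: ifP => [|_].
  rewrite !word_val_cons IH; last by rewrite -ltnS ltnW.
  rewrite [RHS]mulgA !letter_val_fold -!word_val_cat => xy; congr (_ * _)%g; move: xy.
  have [pq pq' p'q p'q'] := fold_neq.
  rewrite /unfold_pair /unfold_letter => /orP[]/andP[/eqP-> /eqP->].
    have /eqP/negbTE-> := pq; have /eqP/negbTE-> := pq'; rewrite !eqxx.
    by rewrite !word_val_cons word_val_nil mulg1 letter_val_inv mulVKg.
  have /negbTE-> := inv_letter_neq q; have /eqP/negbTE-> := p'q.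
  have /eqP/negbTE-> := p'q'; rewrite !eqxx eq_sym; have /eqP/negbTE-> := pq'.
  by rewrite !word_val_cons word_val_nil !letter_val_inv mulg1 mulgV mulg1.
rewrite word_val_cat -letter_val_fold.
rewrite -[X in (_ * word_val R X)%g]/(unfold_word (y :: v)) IH; last by rewrite -ltnS.
by rewrite -word_val_cons.
Qed.

Lemma unfold_word_cat u v :
  good_cut u v -> unfold_word (u ++ v) = unfold_word u ++ unfold_word v.
Proof.
have [k] := ubnP (size u); elim: k u v => // k IH [|x [|y u]] v sk h //.
  by case: v h => [|y v] /=; [rewrite cats0|move=> /negbTE ->].
rewrite /= in sk h *; case: ifP => _.
  by rewrite IH ?ltnS 1?ltnW //; case: u h {sk}.
rewrite -[LHS]/(unfold_letter x ++ unfold_word ((y :: u) ++ v)).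
by rewrite (IH (y :: u) v sk h) /= catA.
Qed.

(** The first letter of the image is that of the word, except that [q] yields
    [p^-1 q] and the cancelling pair [p q] yields [q]. *)
Lemma unfold_word_head y v : exists z w, unfold_word (y :: v) = z :: w /\
  [\/ z = y /\ y <> q, y = q /\ z = inv p | [/\ y = p, z = q & ohead v = Some q]].
Proof.
case: v => [|y' v] /=; rewrite /unfold_letter.
  have [->|/eqP yq] := eqVneq y q; first by exists (inv p), [:: q]; split=> //; constructor 2.
  by case: ifP => [/eqP->|_]; [exists (inv q), [:: p]|exists y, [::]];
     split=> //; constructor 1; split=> //; apply/eqP/inv_letter_neq.
case: ifP => [/orP[]/andP[/eqP-> /eqP->]|_].
- rewrite /unfold_pair eqxx; eexists _, _; split; first by [].
  by constructor 3.
- rewrite /unfold_pair eq_sym; have [_ /eqP/negbTE-> _ _] := fold_neq.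
  eexists _, _; split; first by [].
  by constructor 1; split=> //; apply/eqP/inv_letter_neq.
have [->|/eqP yq] := eqVneq y q.
  by eexists _, _; split; [by []|constructor 2].
case: ifP => [/eqP->|_]; eexists _, _; (split; first by []); constructor 1 => //.
by split=> //; apply/eqP/inv_letter_neq.
Qed.

(** Bounded cancellation with constant one: the letter before an image block and
    the first letter of the next one, as given by [unfold_word_head], could only
    cancel if the original letters did or formed a cancelling pair. *)
Lemma unfold_word_reduced u : reduced u -> reduced (unfold_word u).
Proof.
have [pq pq' p'q p'q'] := fold_neq.
have K := @inv_letterK n; have qq := elimN eqP (inv_letter_neq q).
have pp := elimN eqP (inv_letter_neq p).
have [k] := ubnP (size u); elim: k u => // k IH [|x [|y v]] // sk.
  move=> _; rewrite /= /unfold_letter; case: ifP => _.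
    by rewrite !reducedE /= andbT; apply/eqP; rewrite K; congruence.
  by case: ifP => // _; rewrite !reducedE /= andbT; apply/eqP; rewrite K.
have red_cons z w : reduced (z :: w) = (if w is z' :: _ then compat z z' else true) && reduced w.
  by case: w.
rewrite red_cons => /andP[/eqP xy r] /=.
case: ifP => [can|/negbT/norP[can1 can2]].
  have rv : reduced v := @reduced_catr _ [:: y] v r.
  rewrite red_cons IH ?andbT //; last by rewrite -ltnS ltnW.
  case: v r {rv sk} => // z v; rewrite red_cons => /andP[/eqP yz _].
  have [h [w [-> hh]]] := unfold_word_head z v.
  apply/eqP => e.
  case/orP: can => /andP[/eqP ex /eqP ey]; move: e; rewrite /unfold_pair ex.
    rewrite eqxx => e; case: hh => [[? ?]|[? ?]|[? ? _]]; congruence.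
  have /eqP/negbTE-> : inv q <> p by congruence.
  rewrite K => e; case: hh => [[? ?]|[? ?]|[? ? _]]; try congruence.
have rr : reduced (unfold_word (y :: v)) by rewrite IH // -ltnS.
have [h [w [ew hh]]] := unfold_word_head y v; rewrite -/(unfold_word (y :: v)) ew in rr *.
rewrite /unfold_letter; case: ifP => [/eqP ex|/eqP xq].
  rewrite [_ ++ _]/= 2!red_cons rr andbT /compat K.
  apply/andP; split; apply/eqP; first congruence.
  case: hh => [[? ?]|[? ?]|[? ? _]]; congruence.
case: ifP => [/eqP ex|/eqP xq'].
  rewrite [_ ++ _]/= 2!red_cons rr andbT /compat K.
  apply/andP; split; apply/eqP; first congruence.
  move: can2; rewrite ex eqxx /= => /eqP can2.
  case: hh => [[? ?]|[? ?]|[? ? _]]; congruence.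
rewrite [_ ++ _]/= red_cons rr andbT /compat; apply/eqP => e.
case: hh => [[? ?]|[yq hp]|[? ? _]]; [congruence| |congruence].
move: can1; rewrite yq eqxx andbT => /eqP; apply.
by rewrite -[x]K -e hp K.
Qed.

End Fold.

(** * Periodic words and common periodic stretches *)

Section Powers.
Variables (n : nat) (F : groupType).
Implicit Types (b : 'I_n -> F) (R : labeled_rose n F) (x y : 'I_n * bool)
  (u v c : seq ('I_n * bool)) (g h a w : F).

Definition word_pow k c : seq ('I_n * bool) := flatten (nseq k c).

Definition cyc_reduced c := cycle (@compat n) c.

Lemma word_powS k c : word_pow k.+1 c = c ++ word_pow k c. Proof. by []. Qed.

Lemma word_pow0 c : word_pow 0 c = [::]. Proof. by []. Qed.

Lemma word_pow_rot k u v : word_pow k.+1 (u ++ v) = u ++ word_pow k (v ++ u) ++ v.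
Proof.
elim: k => [|k IH]; first by rewrite word_powS !word_pow0 cats0.
by rewrite word_powS IH word_powS -(catA (v ++ u)) -!(catA u) -(catA v).
Qed.

Lemma word_powSr k c : word_pow k.+1 c = word_pow k c ++ c.
Proof.
by elim: k => [|k IH]; [rewrite word_powS word_pow0 cats0|rewrite word_powS {1}IH word_powS catA].
Qed.

Lemma word_val_pow b k c : word_val b (word_pow k c) = (word_val b c ^+ k)%g.
Proof.
elim: k => [|k IH]; first by rewrite word_pow0 word_val_nil.
by rewrite word_powS word_val_cat IH expgS.
Qed.

Lemma cyc_reducedE c : cyc_reduced c = reduced (c ++ c).
Proof.
rewrite /cyc_reduced; case: c => // x c.
by rewrite reduced_cat andbA andbb /= rcons_path.
Qed.

Lemma reduced_cat_pow k u c v : c != [::] -> cyc_reduced c ->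
  reduced (u ++ c ++ v) -> reduced (u ++ word_pow k.+1 c ++ v).
Proof.
move=> c0 cc r; elim: k => [|k IH]; first by rewrite word_powS !word_pow0 cats0.
rewrite word_powS -(catA c); apply: reduced_glue => //.
  by move: r; rewrite catA => /reduced_catl.
rewrite word_powS -(catA c); apply: reduced_glue => //; first by rewrite -cyc_reducedE.
by move: IH => /reduced_catr; rewrite word_powS -(catA c).
Qed.

(** Peel off the outer letters as long as the last one is the inverse of the first. *)
Lemma cyc_decomp u : reduced u ->
  exists v c, u = v ++ c ++ inv_word v /\ cyc_reduced c.
Proof.
have [k] := ubnP (size u); elim: k u => // k IH u su ru.
have [cu|ncu] := boolP (cyc_reduced u).
  by exists [::], u; rewrite cats0.
case: u su ru ncu => // x u; case/lastP: u => [|u y] su ru.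
  by rewrite /cyc_reduced /= andbT /compat eq_sym inv_letter_neq.
rewrite cyc_reducedE -rcons_cons reduced_cat_rcons_cons rcons_cons !ru /=.
rewrite negbK => /eqP xy.
have [||h [c [eu cc]]] := IH u.
- by move: su; rewrite /= size_rcons; lia.
- by move: ru; rewrite -cats1 -cat1s => /reduced_catr /reduced_catl.
exists (x :: h), c; split=> //.
by rewrite {1}eu inv_word_cons xy inv_letterK /= !rcons_cat -!cats1.
Qed.

(** Multiplying by at most as many letters as [u] has cannot reach beyond [u], so
    what follows [u] in the reduced word is left untouched. *)
Lemma trim_left b (g : seq ('I_n * bool)) u v : (size g <= size u)%N -> reduced (u ++ v) ->
  exists2 u', reduced (u' ++ v) & word_val b u' = (word_val b g * word_val b u)%g.
Proof.
elim/last_ind: g u => [|g x IH] u; first by exists u; rewrite // word_val_nil mul1g.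
rewrite size_rcons; case: u => // y u su r.
have [yx|yx] := eqVneq y (inv_letter x).
  have [u' ru' vu'] := IH u su (@reduced_catr _ [:: y] _ r).
  exists u' => //; rewrite vu' word_val_rcons word_val_cons yx letter_val_inv.
  by rewrite -mulgA mulVKg.
have [||u' ru' vu'] := IH (x :: y :: u).
- by rewrite /= ltnW // ltnS ltnW.
- by rewrite reducedE /= in r *; rewrite r andbT.
exists u' => //; by rewrite vu' word_val_rcons !word_val_cons !mulgA.
Qed.

Lemma trim_right b (g : seq ('I_n * bool)) u v : (size g <= size u)%N -> reduced (v ++ u) ->
  exists2 u', reduced (v ++ u') & word_val b u' = (word_val b u * word_val b g)%g.
Proof.
move=> su r.
have [||u' ru' vu'] := @trim_left b (inv_word g) (inv_word u) (inv_word v).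
- by rewrite !size_inv_word.
- by rewrite -inv_word_cat reduced_inv.
exists (inv_word u'); last by rewrite word_val_inv vu' !word_val_inv invgM !invgK.
by rewrite -reduced_inv inv_word_cat inv_wordK.
Qed.

Definition runs R c k a X Y := exists (P Q : seq ('I_n * bool)),
  [/\ reduced (P ++ word_pow k c ++ Q), word_val R P = (X^-1 * a)%g &
      word_val R (P ++ word_pow k c ++ Q) = (X^-1 * Y)%g].

(** All the geodesics prescribed by [D] run through the same [k] periods of the
    axis of [w], starting at the vertex [a] of the axis. In the application [D]
    contains pairs on both sides of an edge of the last tree. *)
Definition overlap R w k (D : F -> F -> Prop) := exists a c,
  [/\ cyc_reduced c, word_val R c = (w ^ a)%g &
      forall X Y, D X Y -> runs R c k a X Y].

(** A version of [overlap] that ignores the period and tolerates an error [B] at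
    both ends. The common stretch is kept oriented, from [a] to [b], because this
    is what allows a periodic stretch to be recovered in [near_overlap]. *)
Definition near R a (b : F) B (D : F -> F -> Prop) := forall X Y, D X Y ->
  exists u1 u2 u3 (g1 g2 : seq ('I_n * bool)),
  [/\ reduced (u1 ++ u2 ++ u3), word_val R (u1 ++ u2 ++ u3) = (X^-1 * Y)%g,
      (size g1 <= B)%N /\ (size g2 <= B)%N,
      (X * word_val R u1 * word_val R g1)%g = a &
      (X * word_val R (u1 ++ u2) * word_val R g2)%g = b].

Lemma overlap_near R w k D : overlap R w k D ->
  exists a, near R a (w ^+ k * a)%g 0 D.
Proof.
move=> [a [c [_ vc h]]]; exists a => X Y /h[P [Q [r vP vPQ]]].
exists P, (word_pow k c), Q, [::], [::]; split=> //; rewrite !word_val_nil !mulg1 ?vP ?mulVKg //.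
by rewrite word_val_cat vP word_val_pow vc mulgA mulVKg -conjXg conjgE mulVKg.
Qed.

(** In the new tree [a] and [w^(k+1) a] are joined by a word [h c^(k+1) h^-1] with
    [c] cyclically reduced. Discarding [B] letters of the periodic part at each end
    leaves at least [k] periods, as [c] has at least [2 B] letters, and by
    [trim_left] and [trim_right] these lie on every geodesic whose ends are within
    [B]. The cut points do not depend on the geodesic. *)
Lemma near_overlap R w k a B D : w <> 1%g ->
  (forall c g, word_val R c = (w ^ g)%g -> (B.*2 <= size c)%N) ->
  near R a (w ^+ k.+1 * a)%g B D -> overlap R w k D.
Proof.
move=> w1 hB hnear.
have [h [c [eu cc]]] := cyc_decomp (rword_reduced R (w ^ a)%g).
have ru := rword_reduced R (w ^ a)%g; rewrite eu in ru.
have vu : (word_val R h * word_val R c * (word_val R h)^-1)%g = (w ^ a)%g.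
  by rewrite -word_val_inv -mulgA -!word_val_cat -eu rword_val.
have vc : word_val R c = (w ^ (a * word_val R h))%g.
  by rewrite conjgM -vu conjgE -!mulgA mulKg mulVg mulg1.
have c0 : c != [::].
  apply/eqP => c0; apply: w1; move: vc; rewrite c0 word_val_nil => /esym/eqP.
  by rewrite conjg_eq1 => /eqP.
have sc := hB _ _ vc.
(* Starting the period [B] letters later leaves [z1] before and [z2] after the
   [k] periods of [z2 ++ z1]; both have at least [B] letters. *)
pose z1 := take B c; pose z2 := drop B c.
have ez : z1 ++ z2 = c by rewrite cat_take_drop.
have s1 : size z1 = B by rewrite size_takel //; lia.
have s2 : (B <= size z2)%N by rewrite size_drop; lia.
pose U1 := h ++ z1; pose U2 := word_pow k (z2 ++ z1); pose U3 := z2 ++ inv_word h.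
have rU : reduced (U1 ++ U2 ++ U3).
  have := reduced_cat_pow k c0 cc ru.
  by rewrite -ez word_pow_rot /U1 /U2 /U3 -!catA.
have vU : word_val R (U1 ++ U2 ++ U3) = ((w ^+ k.+1) ^ a)%g.
  have -> : U1 ++ U2 ++ U3 = h ++ word_pow k.+1 c ++ inv_word h.
    by rewrite -ez word_pow_rot /U1 /U2 /U3 -!catA.
  rewrite word_val_cat word_val_cat word_val_pow word_val_inv.
  have -> : (word_val R h * (word_val R c ^+ k.+1 * (word_val R h)^-1))%g =
            ((word_val R c ^+ k.+1) ^ (word_val R h)^-1)%g by rewrite conjgE invgK.
  by rewrite conjXg vc conjgM conjgK -conjXg.
exists (a * word_val R U1)%g, (z2 ++ z1); split.
- by rewrite -[z2 ++ z1]/(rot B c) /cyc_reduced rot_cycle.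
- rewrite word_val_cat /U1 word_val_cat [(a * _)%g]mulgA conjgM -vc -ez word_val_cat conjgE.
  by rewrite -mulgA mulKg.
move=> X Y /hnear[u1 [u2 [u3 [g1 [g2 [r v [sg1 sg2] e1 e2]]]]]].
have [|U1' rU1 vU1] := @trim_left R g1 U1 (U2 ++ U3) _ rU.
  by rewrite size_cat s1 (leq_trans sg1) // leq_addl.
have [||U3' rU3 vU3] := @trim_right R (inv_word g2) U3 (U1' ++ U2).
- by rewrite size_inv_word size_cat (leq_trans sg2) // (leq_trans s2) ?leq_addr.
- by rewrite -catA.
have eu2 : u2 = U1' ++ U2 ++ U3'.
  have ru2 : reduced u2 by move: r => /reduced_catr/reduced_catl.
  rewrite -(rword_uniq R ru2); apply: rword_eq; first by rewrite catA.
  rewrite word_val_cat vU1 [word_val R (U2 ++ _)]word_val_cat vU3 word_val_inv.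
  rewrite -mulgA [(word_val R U1 * _)%g]mulgA -word_val_cat.
  rewrite [(_ * (word_val R U3 * _))%g]mulgA -word_val_cat -catA vU.
  move: e1 e2; rewrite word_val_cat => <-.
  rewrite conjgE => e; rewrite -e !invgM !mulgA.
  by rewrite mulgV mul1g mulgVK mulVg mul1g mulgK.
exists (u1 ++ U1'), (U3' ++ u3); split.
- by move: r; rewrite eu2 -!catA.
- by rewrite word_val_cat vU1 !mulgA -e1 -!mulgA mulKg.
- by rewrite -v eu2 -!catA.
Qed.

End Powers.

(** * The effect of one fold *)

Section Steps.
Variables (n : nat) (F : groupType).
Variables (R R' : labeled_rose n F) (p q : 'I_n * bool).
Hypothesis fold_pq : is_fold_along R R' p q.
Implicit Types (x y : 'I_n * bool) (u v c : seq ('I_n * bool)) (g h a o : F).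
Local Notation inv := (@inv_letter n).
Local Notation U := (unfold_word p q).
Local Notation good_cut := (good_cut p q).

(** The letter [p] only cancels to its right, and its inverse only to its left. *)
Lemma good_cut_consp u v : good_cut u (p :: v).
Proof.
case: u => // x u; rewrite /= /cancelling; have [/eqP/negbTE-> _ _ _] := fold_neq fold_pq.
by rewrite andbF /= [p == _]eq_sym (negbTE (inv_letter_neq p)) andbF.
Qed.

Lemma good_cut_rconsp u v : good_cut (rcons u (inv p)) v.
Proof.
have k y : ~~ cancelling p q (inv p) y.
  have [_ _ _ /eqP/negbTE e] := fold_neq fold_pq.
  by rewrite /cancelling e (negbTE (inv_letter_neq p)).
by case: v => [|y v]; case: u => //= x u; rewrite last_rcons.
Qed.

Lemma good_cut_catl u c v : c != [::] -> good_cut (u ++ c) v = good_cut c v.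
Proof. by case: u => // y u; case: c => // x c _; case: v => //= z v; rewrite last_cat. Qed.

Lemma good_cut_catr u c v : c != [::] -> good_cut u (c ++ v) = good_cut u c.
Proof. by case: c. Qed.

Lemma bad_cutP u v : ~~ good_cut u v ->
  (exists u0 v0, u = rcons u0 p /\ v = q :: v0) \/
  (exists u0 v0, u = rcons u0 (inv q) /\ v = inv p :: v0).
Proof.
case/lastP: u => // u x; case: v => [|y v]; first by case: u.
have -> : good_cut (rcons u x) (y :: v) = ~~ cancelling p q x y.
  by case: u => //= z u; rewrite last_rcons.
rewrite negbK => /orP[]/andP[/eqP-> /eqP->]; [left|right]; by exists u, v.
Qed.

(** When every cut between consecutive periods and at both ends is good, the
    periodic stretch is rewritten piece by piece. *)
Lemma overlap_unfold w k (D : F -> F -> Prop) a c :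
  cyc_reduced c -> good_cut c c -> word_val R' c = (w ^ a)%g ->
  (forall X Y, D X Y -> exists (P Q : seq ('I_n * bool)),
     [/\ reduced (P ++ word_pow k c ++ Q), word_val R' P = (X^-1 * a)%g,
         word_val R' (P ++ word_pow k c ++ Q) = (X^-1 * Y)%g,
         good_cut P (word_pow k c ++ Q) & good_cut c Q]) ->
  overlap R w k D.
Proof.
move=> cc gcc vc h; exists a, (U c); split.
- rewrite cyc_reducedE -unfold_word_cat //; apply: unfold_word_reduced => //.
    exact: fold_pq.
  by rewrite -cyc_reducedE.
- by rewrite (unfold_word_val fold_pq).
move=> X Y /h[P [Q [r vP v g1 g2]]].
have eU : U (P ++ word_pow k c ++ Q) = U P ++ word_pow k (U c) ++ U Q.
  rewrite unfold_word_cat //; congr cat.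
  elim: k {r v g1 h} => // k IH; rewrite !word_powS -(catA c) -(catA (U c)) -IH.
  apply: unfold_word_cat; case: k {IH} => // k.
  by have [->//|c0] := eqVneq c [::]; rewrite word_powS -(catA c) good_cut_catr.
exists (U P), (U Q); rewrite -eU !(unfold_word_val fold_pq); split=> //.
by apply: unfold_word_reduced => //; exact: fold_pq.
Qed.

(** If the period [c] cancels against its own next copy, moving the base point
    across the letter [p] involved makes all the cuts good, since [p^-1] never
    cancels to its right and [p] never to its left. Otherwise the inner cuts are
    good; a bad cut at the start of one geodesic and one at the end of another
    would force [c] to start and end with letters that cancel in one way or the
    other. So one of the two ends is good for all geodesics, and dropping the
    period at the other end replaces the bad cut by an inner one. *)
Lemma fold_overlap w k (D : F -> F -> Prop) :
  w <> 1%g -> overlap R' w k.+1 D -> overlap R w k D.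
Proof.
move=> w1 [a [c [cc vc h]]].
have c0 : c != [::].
  apply/eqP => c0; apply: w1; move: vc; rewrite c0 word_val_nil => /esym/eqP.
  by rewrite conjg_eq1 => /eqP.
have [gcc|/bad_cutP[]] := boolP (good_cut c c); last first.
- move=> [_ [c1 [_ ec]]].
  have ec1 : rcons c1 (inv p) = rot 1 c by rewrite ec rot1_cons.
  apply: (@overlap_unfold _ _ _ (a * word_val R' [:: inv p])%g (rcons c1 (inv p))).
  + by rewrite /cyc_reduced ec1 rot_cycle.
  + exact: good_cut_rconsp.
  + by rewrite conjgM -vc ec word_val_rcons word_val1 word_val_cons conjgE -mulgA mulKg.
  move=> X Y /h[P [Q [r vP v]]]; exists (rcons P (inv p)), (c1 ++ Q).
  have e : rcons P (inv p) ++ word_pow k (rcons c1 (inv p)) ++ c1 ++ Q = P ++ word_pow k.+1 c ++ Q.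
    have -> : word_pow k.+1 c = inv p :: word_pow k (rcons c1 (inv p)) ++ c1.
      by rewrite ec -cats1; exact: (word_pow_rot k [:: inv p] c1).
    by move: (word_pow k _) => W; rewrite cat_rcons /= catA.
  rewrite e; split=> //.
  + by rewrite word_val_rcons vP word_val1 mulgA.
  + exact: good_cut_rconsp.
  + exact: good_cut_rconsp.
- move=> [c1 [_ [ec _]]].
  have ec1 : p :: c1 = rotr 1 c by rewrite ec rotr1_rcons.
  apply: (@overlap_unfold _ _ _ (a * word_val R' c1)%g (p :: c1)).
  + by rewrite /cyc_reduced ec1 rotr_cycle.
  + exact: good_cut_consp.
  + by rewrite conjgM -vc ec word_val_rcons word_val_cons conjgE -mulgA mulKg.
  move=> X Y /h[P [Q [r vP v]]]; exists (P ++ c1), (p :: Q).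
  have e : (P ++ c1) ++ word_pow k (p :: c1) ++ p :: Q = P ++ word_pow k.+1 c ++ Q.
    rewrite ec -cats1 word_pow_rot; rewrite -[[:: p] ++ c1]/(p :: c1).
    by move: (word_pow k _) => W; rewrite -!catA.
  rewrite e; split=> //.
  + by rewrite word_val_cat vP mulgA.
  + by case: (k) => [|k']; exact: good_cut_consp.
  + exact: good_cut_consp.
pose dec X Y P Q := [/\ reduced (P ++ word_pow k.+1 c ++ Q), word_val R' P = (X^-1 * a)%g &
  word_val R' (P ++ word_pow k.+1 c ++ Q) = (X^-1 * Y)%g].
have [hl|/existsNP[X0 /existsNP[Y0 /not_implyP[D0 /forallNP hl]]]] :=
  pselect (forall X Y, D X Y -> exists P, good_cut P c /\ exists Q, dec X Y P Q).
- apply: (overlap_unfold cc gcc vc) => X Y /hl[P [gP [Q [r vP v]]]].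
  have e : word_pow k c ++ c ++ Q = word_pow k.+1 c ++ Q by rewrite word_powSr catA.
  exists P, (c ++ Q); rewrite e; split=> //; last by rewrite good_cut_catr.
  by rewrite word_powS -(catA c) good_cut_catr.
have hr X Y : D X Y -> exists P Q, good_cut c Q /\ dec X Y P Q.
  move=> /h[P [Q dPQ]]; exists P, Q; split=> //.
  have key x y u v : c = rcons u y -> c = x :: v -> compat y x && ~~ cancelling p q y x.
    move=> e1 e2; move: (cc) (gcc); rewrite cyc_reducedE {1 3}e1 {1 2}e2.
    rewrite reduced_cat_rcons_cons => /and3P[_ _ ->] /=.
    by case: (u) => //= z u'; rewrite last_rcons.
  have [P0 [Q0 d0]] := h _ _ D0.
  have [gP0|badP0] := boolP (good_cut P0 c).
    by have := hl P0; case; split=> //; exists Q0.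
  apply: contraT => badQ; rewrite -(negbTE (inv_letter_neq p)).
  case: (bad_cutP badP0) => -[_ [v0 [_ ec]]]; case: (bad_cutP badQ) => -[u1 [_ [ec' _]]];
    have := key _ _ _ _ ec' ec.
  - by rewrite /cancelling !eqxx andbF.
  - by rewrite /compat inv_letterK eqxx.
  - by rewrite /compat eqxx.
  - by rewrite /cancelling !eqxx orbT andbF.
apply: (@overlap_unfold _ _ _ (a * word_val R' c)%g c) => //.
  by rewrite conjgM -vc conjgE mulKg.
move=> X Y /hr[P [Q [gQ [r vP v]]]].
have e : (P ++ c) ++ word_pow k c ++ Q = P ++ word_pow k.+1 c ++ Q by rewrite word_powS -!catA.
exists (P ++ c), Q; rewrite e; split=> //; first by rewrite word_val_cat vP mulgA.
rewrite good_cut_catl //; case: (k) => // k'.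
by rewrite word_powS -(catA c) good_cut_catr.
Qed.

(** Read letter by letter, without cancelling, the rewriting at most doubles the
    length. *)
Lemma unfold_size (g : seq ('I_n * bool)) :
  exists2 g', (size g' <= (size g).*2)%N & word_val R g' = word_val R' g.
Proof.
elim: g => [|x g [g' sg vg]]; first by exists [::]; rewrite // !word_val_nil.
exists (unfold_letter p q x ++ g').
  rewrite size_cat; have : (size (unfold_letter p q x) <= 2)%N.
    by rewrite /unfold_letter; case: ifP => // _; case: ifP.
  by rewrite /=; lia.
by rewrite word_val_cat vg -(letter_val_fold fold_pq) word_val_cons.
Qed.

Lemma word_val_p : word_val R' [:: p] = word_val R [:: p].
Proof.
rewrite !word_val1 (letter_val_fold fold_pq) /unfold_letter.
have [/eqP/negbTE-> /eqP/negbTE-> _ _] := fold_neq fold_pq.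
by rewrite word_val1.
Qed.

(** A bad cut is repaired by moving it across the neighbouring letter [p] or its
    inverse; two ordered cuts stay ordered, since a letter crossed by both would
    have to be both [p] and its inverse. *)
Lemma good_cuts u1 u2 u3 : exists v1 v2 v3 t1 t2,
  [/\ v1 ++ v2 ++ v3 = u1 ++ u2 ++ u3,
      good_cut v1 (v2 ++ v3) /\ good_cut v2 v3,
      (size t1 <= 1)%N /\ (size t2 <= 1)%N,
      word_val R' u1 = (word_val R' v1 * word_val R t1)%g &
      word_val R' (u1 ++ u2) = (word_val R' (v1 ++ v2) * word_val R t2)%g].
Proof.
have mv1 u : word_val R' (rcons u p) = (word_val R' u * word_val R [:: p])%g.
  by rewrite -cats1 word_val_cat word_val_p.
have mv2 u : word_val R' u = (word_val R' (rcons u (inv p)) * word_val R [:: p])%g.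
  by rewrite -word_val_p word_val_rcons word_val1 letter_val_inv mulgVK.
have mv0 u : word_val R' u = (word_val R' u * word_val R [::])%g.
  by rewrite word_val_nil mulg1.
have [->|u20] := eqVneq u2 [::].
  have [g|/bad_cutP[[u0 [v0 [-> ->]]]|[_ [v0 [_ ->]]]]] := boolP (good_cut u1 u3).
  - by exists u1, [::], u3, [::], [::]; rewrite !cats0.
  - exists u0, [::], (p :: q :: v0), [:: p], [:: p].
    by rewrite !cats0 cat_rcons; split=> //; split=> //; exact: good_cut_consp.
  - exists (rcons u1 (inv p)), [::], v0, [:: p], [:: p].
    by rewrite !cats0 cat_rcons; split=> //; split=> //; exact: good_cut_rconsp.
have [v1 [w2 [t1 [e g1 s1 vt1]]]] : exists v1 w2 t1, [/\ v1 ++ w2 = u1 ++ u2,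
    good_cut v1 (w2 ++ u3), (size t1 <= 1)%N &
    word_val R' u1 = (word_val R' v1 * word_val R t1)%g].
  have [g|/bad_cutP[[u0 [_ [-> _]]]|[_ [v0 [_ ->]]]]] := boolP (good_cut u1 u2).
  - by exists u1, u2, [::]; rewrite good_cut_catr.
  - exists u0, (p :: u2), [:: p]; rewrite cat_rcons; split=> //; exact: good_cut_consp.
  - exists (rcons u1 (inv p)), v0, [:: p]; rewrite cat_rcons; split=> //.
    exact: good_cut_rconsp.
have e3 : v1 ++ w2 ++ u3 = u1 ++ u2 ++ u3 by rewrite !catA e.
have [g|/bad_cutP[[w [v0 [ew eu]]]|[_ [v0 [_ eu]]]]] := boolP (good_cut w2 u3).
- by exists v1, w2, u3, t1, [::]; rewrite e.
- have ew3 : w ++ p :: u3 = w2 ++ u3 by rewrite ew cat_rcons.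
  exists v1, w, (p :: u3), t1, [:: p]; rewrite ew3; split=> //.
    by split=> //; exact: good_cut_consp.
  by rewrite -e ew -rcons_cat.
- have ew3 : rcons w2 (inv p) ++ v0 = w2 ++ u3 by rewrite eu cat_rcons.
  exists v1, (rcons w2 (inv p)), v0, t1, [:: p]; rewrite ew3; split=> //.
    by split=> //; exact: good_cut_rconsp.
  by rewrite -e -rcons_cat.
Qed.

Lemma fold_near a b B D : near R' a b B D -> near R a b B.*2.+1 D.
Proof.
move=> h X Y /h[u1 [u2 [u3 [g1 [g2 [r v [s1 s2] e1 e2]]]]]].
have [v1 [v2 [v3 [t1 [t2 [e [gc1 gc2] [st1 st2] vt1 vt2]]]]]] := good_cuts u1 u2 u3.
have [h1 sh1 vh1] := unfold_size g1; have [h2 sh2 vh2] := unfold_size g2.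
have eU : U (v1 ++ v2 ++ v3) = U v1 ++ U v2 ++ U v3 by rewrite !unfold_word_cat.
exists (U v1), (U v2), (U v3), (t1 ++ h1), (t2 ++ h2); split.
- by rewrite -eU e; apply: unfold_word_reduced => //; exact: fold_pq.
- by rewrite -eU e (unfold_word_val fold_pq).
- by rewrite !size_cat; split; lia.
- by rewrite (unfold_word_val fold_pq) word_val_cat vh1 -e1 vt1 !mulgA.
- have gc12 : good_cut v1 v2.
    by have [->|v20] := eqVneq v2 [::]; [case: (v1)|rewrite -(good_cut_catr _ v3 v20)].
  rewrite -(unfold_word_cat gc12) (unfold_word_val fold_pq).
  rewrite [word_val R (t2 ++ h2)]word_val_cat vh2 -e2 vt2.
  by rewrite !mulgA.
Qed.

End Steps.

(** * Folding sequences *)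

Section Sequences.
Variables (n : nat) (F : groupType) (m : nat) (Rs : nat -> labeled_rose n F).
Hypothesis Rs_fold : folding_sequence m Rs.
Variables (w : F) (w1 : w <> 1%g) (D : F -> F -> Prop).

Lemma overlap_seq i j k : (i + j <= m)%N ->
  overlap (Rs i) w (j + k) D -> overlap (Rs (i + j)) w k D.
Proof.
elim: j i => [|j IH] i; first by rewrite addn0.
rewrite addnS => ijm h; rewrite -addSn; apply: IH; first by rewrite addSn.
have [p [q pq]] := Rs_fold (leq_ltn_trans (leq_addr j i) ijm).
exact: fold_overlap pq _ _ _ w1 h.
Qed.

(** The bound satisfies [B_(j+1) + 1 = 2 (B_j + 1)]. *)
Lemma near_seq i j a b B : (i + j <= m)%N ->
  near (Rs i) a b B D -> near (Rs (i + j)) a b (2 ^ j * B.+1).-1 D.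
Proof.
elim: j i B => [|j IH] i B; first by rewrite addn0 mul1n.
rewrite addnS => ijm h; rewrite -addSn.
have [p [q pq]] := Rs_fold (leq_ltn_trans (leq_addr j i) ijm).
have := IH i.+1 B.*2.+1; rewrite addSn => /(_ ijm (fold_near pq h)).
by rewrite expnSr -mulnA mul2n doubleS.
Qed.

Lemma overlap_seq_long i j k : (i + j <= m)%N ->
  (forall c g, word_val (Rs (i + j)) c = (w ^ g)%g -> ((2 ^ j).-1.*2 <= size c)%N) ->
  overlap (Rs i) w k.+1 D -> overlap (Rs (i + j)) w k D.
Proof.
move=> ijm hlen /overlap_near[a /(near_seq ijm)]; rewrite muln1.
exact: near_overlap.
Qed.

Definition separated R o x := forall s : bool, exists X Y : F,
  [/\ D X Y, @side n F R o x X = s & side R o x Y = s].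

(** A common point of the geodesics would lie on both sides, by convexity. *)
Lemma separated_no_overlap R o x k : separated R o x -> overlap R w k D -> False.
Proof.
move=> sep [a [c [_ _ h]]].
have key s : side R o x a = s.
  have [X [Y [DXY sX sY]]] := sep s; have [P [Q [r vP v]]] := h _ _ DXY.
  have := @side_convex _ _ R o x X P (word_pow k c ++ Q) s r sX.
  by rewrite v vP !mulVKg; exact.
by have := key true; rewrite (key false).
Qed.

Lemma overlap_lt o x k : separated (Rs m) o x -> overlap (Rs 0) w k D -> (k < m)%N.
Proof.
move=> sep h; rewrite ltnNge; apply/negP => mk.
apply: separated_no_overlap sep (@overlap_seq 0 m (k - m) _ _) => //.
by rewrite subnKC.
Qed.

(** Each block of [p] steps loses one period. If [k p] exceeded [m], a period would
    be left after the last full block, and the remaining steps, fewer than [p],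
    would leave an overlap in the last tree. *)
Lemma overlap_mul_le o x k p :
  (forall i c g, (i <= m)%N -> word_val (Rs i) c = (w ^ g)%g -> ((2 ^ p).-1.*2 <= size c)%N) ->
  separated (Rs m) o x -> overlap (Rs 0) w k D -> (k * p <= m)%N.
Proof.
move=> hlen sep h; rewrite leqNgt; apply/negP => mkp.
have p0 : (0 < p)%N by case: (p) mkp => //; rewrite muln0.
have block q : (q <= k)%N -> (q * p <= m)%N -> overlap (Rs (q * p)) w (k - q) D.
  elim: q => [|q IH] qk qpm; first by rewrite subn0.
  rewrite mulSn addnC; apply: overlap_seq_long.
  - by rewrite addnC -mulSn.
  - by move=> c g; apply: hlen; rewrite addnC -mulSn.
  - rewrite -subSn // subSS; apply: IH; first exact: ltnW.
    by rewrite (leq_trans _ qpm) // leq_mul2r leqnSn orbT.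
have qk : (m %/ p < k)%N by rewrite ltn_divLR.
have := block _ (ltnW qk) (leq_divM m p); have -> : (k - m %/ p = (k - m %/ p).-1.+1)%N.
  by rewrite prednK // subn_gt0.
move=> h1; apply: separated_no_overlap sep (_ : overlap _ w (k - m %/ p).-1 D).
rewrite [in Rs m](divn_eq m p); apply: overlap_seq_long h1; rewrite -divn_eq // => c g vc.
apply: leq_trans (hlen _ _ _ (leqnn m) vc).
rewrite leq_double -!subn1 leq_sub2r // leq_exp2l //.
by rewrite ltnW // ltn_mod.
Qed.

End Sequences.

(** * The axis as a periodic line *)

Section Line.
Variables (n : nat) (F : groupType) (R : labeled_rose n F) (w : F).
Variables (l : nat) (l_gt0 : (0 < l)%N).
Variable (lab : nat -> 'I_n * bool).
Hypothesis lab_per : forall i, lab (i + l) = lab i.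
Hypothesis lab_compat : forall i, compat (lab i) (lab i.+1).
Implicit Types (x y : 'I_n * bool) (u v c : seq ('I_n * bool)) (g h a o : F).

(** The line is given by an [l]-periodic sequence of letters [lab], and [seg j k]
    is the word read along its [k] edges that follow the [j]-th vertex. *)
Definition seg j k := [seq lab i | i <- iota j k].

Definition vertex (o : F) j := (o * word_val R (seg 0 j))%g.

Lemma seg_reduced j k : reduced (seg j k).
Proof.
rewrite reducedE /seg; case: k => //= k.
by elim: k j => //= k IH j; rewrite lab_compat IH.
Qed.

Lemma segD j k1 k2 : seg j (k1 + k2) = seg j k1 ++ seg (j + k1) k2.
Proof. by rewrite /seg iotaD map_cat. Qed.

Lemma seg_per j k : seg (j + l) k = seg j k.
Proof. by elim: k j => // k IH j; rewrite /seg /= lab_per -/(seg (j + l).+1 k) -addSn IH. Qed.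

Lemma seg_pow j k : seg j (k * l) = word_pow k (seg j l).
Proof. by elim: k => // k IH; rewrite mulSn segD seg_per IH word_powS. Qed.

Lemma seg_cyc j : cyc_reduced (seg j l).
Proof. by rewrite cyc_reducedE -{2}seg_per -segD seg_reduced. Qed.

Lemma vertexD o j k : vertex o (j + k) = (vertex o j * word_val R (seg j k))%g.
Proof. by rewrite /vertex segD word_val_cat mulgA. Qed.

Lemma vertexS o j : vertex o j.+1 = (vertex o j * letter_val R (lab j))%g.
Proof. by rewrite -addn1 vertexD word_val1. Qed.

Section BasePoint.
Variable o : F.
Hypothesis w_o : (w * o = o * word_val R (seg 0 l))%g.
Local Notation vertex := (vertex o).

Lemma vertex_per j : vertex (j + l) = (w * vertex j)%g.
Proof. by rewrite addnC vertexD -{2}[l]add0n seg_per /vertex !mulgA w_o. Qed.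

Lemma conj_vertex j : (w ^ vertex j)%g = word_val R (seg j l).
Proof. by rewrite conjgE -vertex_per vertexD mulKg. Qed.

(** If the first letter of a path leaving the line followed neither direction of
    the line, conjugating by the whole path would produce a reduced word of length
    greater than [l]. *)
Lemma axis_step j y u : reduced (y :: u) ->
  (size (rword R (w ^ (vertex j * word_val R (y :: u))%g)) <= l)%N ->
  y = lab j \/ y = inv_letter (lab (j + l).-1).
Proof.
move=> ru; have [->|yl] := eqVneq y (lab j); first by left.
rewrite leqNgt => h; right; apply/eqP; apply: contraR h => yl'.
have el : seg j l = rcons (seg j l.-1) (lab (j + l).-1).
  rewrite -{1}(prednK l_gt0) -{1}addn1 segD -cats1 /seg /=.
  by congr (_ ++ [:: lab _]); case: (l) l_gt0 => // l' _; rewrite addnS.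
have el' : seg j l = lab j :: seg j.+1 l.-1 by case: (l) l_gt0.
rewrite conjgM conj_vertex conjgE -word_val_inv -!word_val_cat rword_uniq.
  by rewrite !size_cat size_inv_word size_map size_iota /=; lia.
have l0 : seg j l != [::] by rewrite el'.
apply: reduced_glue => //.
  rewrite el' inv_word_cons reduced_cat_rcons_cons -inv_word_cons reduced_inv ru.
  by rewrite -el' seg_reduced /= /compat inv_letterK eq_sym.
by rewrite el reduced_cat_rcons_cons -el seg_reduced ru /= /compat yl'.
Qed.

Lemma conj_shift M g : (w ^ (w ^+ M * g))%g = (w ^ g)%g.
Proof. by rewrite conjgM [(w ^ (w ^+ M))%g]conjgE -expgS expgSr mulKg. Qed.

(** Follow the path from the line by [axis_step]. A backward step is taken after
    translating by [w], so that positions on the line remain natural numbers. *)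
Lemma axis_vertex_word u j : reduced u ->
  (size (rword R (w ^ (vertex j * word_val R u)%g)) <= l)%N ->
  exists M k, (w ^+ M * (vertex j * word_val R u))%g = vertex k.
Proof.
elim: u j => [|y u IH] j r h; first by exists 0%N, j; rewrite mul1g word_val_nil mulg1.
have ru : reduced u := @reduced_catr _ [:: y] u r.
case: (axis_step r h) => ey.
  by rewrite word_val_cons mulgA ey -vertexS in h *; exact: IH h.
have e : (w * (vertex j * word_val R (y :: u)))%g = (vertex (j + l).-1 * word_val R u)%g.
  rewrite mulgA -vertex_per word_val_cons mulgA ey letter_val_inv; congr (_ * _)%g.
  have {1}-> : (j + l = (j + l).-1.+1)%N by rewrite prednK // addn_gt0 l_gt0 orbT.
  by rewrite vertexS mulgK.
have [|M [k ek]] := IH (j + l).-1 ru.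
  by rewrite -e -{2}[w]expg1 conj_shift.
by exists M.+1, k; rewrite -ek -e expgSr -!mulgA.
Qed.

Lemma axis_vertex g : (size (rword R (w ^ g)%g) <= l)%N ->
  exists M k, (w ^+ M * g)%g = vertex k.
Proof.
have eg : g = (vertex 0 * word_val R (rword R (o^-1 * g)%g))%g.
  by rewrite rword_val /vertex word_val_nil mulg1 mulVKg.
by move=> h; rewrite eg; apply: axis_vertex_word; rewrite -?eg // rword_reduced.
Qed.

End BasePoint.

(** Edges of the tree carry a fixed orientation, which may agree with that of the
    line or not. *)
Definition edge_at o j (e : edge n F) :=
  (e.1 = vertex o j /\ (e.2, false) = lab j) \/
  (e.1 = vertex o j.+1 /\ (e.2, false) = inv_letter (lab j)).

Definition axial (e : edge n F) :=
  (size (rword R (w ^ e.1)%g) <= l)%N /\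
  (size (rword R (w ^ (e.1 * letter_val R (e.2, false)))%g) <= l)%N.

Definition shift M (e : edge n F) : edge n F := ((w ^+ M * e.1)%g, e.2).

Lemma edge_at_inj o j e1 e2 : edge_at o j e1 -> edge_at o j e2 -> e1 = e2.
Proof.
case: e1 e2 => [g1 i1] [g2 i2] [] /= [-> h1] [] /= [-> h2].
- by congr pair; case: (etrans h1 (esym h2)).
- by move: h2; rewrite -h1.
- by move: h1; rewrite -h2.
- by congr pair; case: (etrans h1 (esym h2)).
Qed.

Section EdgePositions.
Variable o : F.
Hypothesis w_o : (w * o = o * word_val R (seg 0 l))%g.

Lemma edge_at_shiftS M j e : edge_at o j (shift M e) -> edge_at o (j + l) (shift M.+1 e).
Proof.
rewrite /edge_at /shift /= expgS -mulgA lab_per -addSn !vertex_per //.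
by case=> -[-> ->]; [left|right].
Qed.

Lemma axial_edge_at e : axial e -> exists M j, edge_at o j (shift M e).
Proof.
case=> /(axis_vertex w_o)[M [k ek]] h2; exists M.+1.
have ek' : (w ^+ M.+1 * e.1)%g = vertex o (k + l) by rewrite expgS -mulgA ek vertex_per.
have h3 : (size (rword R (w ^ (vertex o (k + l) * word_val R [:: (e.2, false)]))%g) <= l)%N.
  by rewrite word_val1 -ek' -mulgA conj_shift.
have [||] := axis_step w_o (_ : reduced [:: (e.2, false)]) h3; [by []| |].
  by move=> h; exists (k + l)%N; left.
have e1 : (k + l = (k + l).-1.+1)%N by rewrite prednK // addn_gt0 l_gt0 orbT.
have -> : ((k + l + l).-1 = (k + l).-1 + l)%N by rewrite {1}e1 addSn.
by rewrite lab_per => h; exists (k + l).-1; right; rewrite -e1.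
Qed.

Lemma vertex_shift M j : vertex (w ^- M * o)%g j = (w ^- M * vertex o j)%g.
Proof. by rewrite /vertex mulgA. Qed.

(** Translating by a power of [w] preserves the line; a large enough power brings
    finitely many edges of the axis to nonnegative positions at once. *)
Lemma line_through (E : seq (edge n F)) : (forall e, e \in E -> axial e) ->
  exists2 o', (w * o' = o' * word_val R (seg 0 l))%g &
   forall e, e \in E -> exists j, edge_at o' j e.
Proof.
move=> hE; have [M hM] : exists M, forall e, e \in E -> exists j, edge_at o j (shift M e).
  elim: E hE => [|e E IH] hE; first by exists 0%N.
  have [|M hM] := IH; first by move=> e' e'E; apply: hE; rewrite inE e'E orbT.
  have [M' [j hj]] := axial_edge_at (hE e (mem_head _ _)).
  have mono k N i e' : edge_at o i (shift N e') -> exists i', edge_at o i' (shift (k + N) e').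
    elim: k i => [|k IHk] i; first by exists i.
    by case/IHk => i' /edge_at_shiftS h; exists (i' + l)%N.
  exists (M + M')%N => e'; rewrite inE => /orP[/eqP->|/hM[i]].
    exact: mono hj.
  by rewrite addnC; exact: mono.
exists (w ^- M * o)%g.
  by rewrite -mulgA -w_o !mulgA; congr (_ * _)%g; exact/commuteV/commuteX.
move=> e /hM[j h]; exists j; rewrite /edge_at !vertex_shift.
by case: h => -[<- <-]; [left|right]; rewrite mulKg.
Qed.
End EdgePositions.

End Line.

(** Distinct elements have distinct positions, so the extreme positions are at
    least [size E - 1] apart. *)
Lemma extreme_elements (T : eqType) (E : seq T) (f : T -> nat) :
  uniq E -> {in E &, injective f} -> E != [::] ->
  exists e0 e1, [/\ e0 \in E, e1 \in E & (f e0 + size E <= (f e1).+1)%N].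
Proof.
move=> uE injf E0.
have [e eE] : exists e, e \in E by case: (E) E0 => // e E' _; exists e; exact: mem_head.
pose P j := has (fun e => f e == j) E.
have exP : exists j, P j by exists (f e); apply/hasP; exists e.
have ubP j : P j -> (j <= \max_(e <- E) f e)%N.
  by case/hasP=> e' e'E /eqP<-; exact: (@leq_bigmax_seq _ E xpredT f).
case: (ex_minnP exP) => _ /hasP[e0 e0E /eqP<-] min0.
case: (ex_maxnP exP ubP) => _ /hasP[e1 e1E /eqP<-] max1.
have b e' : e' \in E -> (f e0 <= f e' <= f e1)%N.
  by move=> e'E; rewrite min0 ?max1 //; apply/hasP; exists e'.
exists e0, e1; split=> //.
have : (size (map f E) <= size (iota (f e0) ((f e1).+1 - f e0)))%N.
  apply: uniq_leq_size; first by rewrite map_inj_in_uniq.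
  by move=> _ /mapP[e' /b e'b ->]; rewrite mem_iota; lia.
by rewrite size_map size_iota; have := b _ e0E; lia.
Qed.

(** * From large twisting to a common periodic stretch *)

Section Twisting.
Variables (n : nat) (F : groupType).
Implicit Types (R : labeled_rose n F) (x y : 'I_n * bool)
  (u v c : seq ('I_n * bool)) (g h a o w : F).

(** An element of minimal length in its conjugacy class has a cyclically reduced
    word, whose periodic repetition labels the axis. *)
Lemma cyclic_line R w o l : (0 < l)%N ->
  (forall g, (l <= size (rword R (w ^ g)%g))%N) ->
  size (rword R (w ^ o)%g) = l ->
  exists lab, [/\ forall i, lab (i + l) = lab i, forall i, compat (lab i) (lab i.+1) &
    (w * o = o * word_val R (seg lab 0 l))%g].
Proof.
move=> l0 lmin; have vc := rword_val R (w ^ o)%g; have rc := rword_reduced R (w ^ o)%g.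
move: (rword R (w ^ o)%g) vc rc => c vc rc sc.
have cc : cyc_reduced c.
  have [v [c' [ec cc]]] := cyc_decomp rc.
  have : (w ^ (o * word_val R v))%g = word_val R c'.
    by rewrite conjgM -vc ec !word_val_cat word_val_inv conjgE -!mulgA mulKg mulVg mulg1.
  move=> ew; have := lmin (o * word_val R v)%g; rewrite ew => h1.
  have := leq_trans h1 (size_rword_le R c'); rewrite -sc ec !size_cat size_inv_word.
  by case: (v) cc => [|y v'] //= cc; [rewrite cats0|lia].
case: c sc vc rc cc => [sc|x0 c' sc vc rc cc]; first by rewrite -sc in l0.
move: (x0 :: c') sc vc rc cc => c sc vc rc cc.
exists (fun i => nth x0 c (i %% l)); split.
- by move=> i; rewrite modnDr.
- move=> i; have il : (i %% l < l)%N by rewrite ltn_mod.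
  have il2 : ((i %% l).+1 < size (c ++ c))%N by rewrite size_cat sc; lia.
  move: cc; rewrite cyc_reducedE => /(sortedP x0) /(_ _ il2); rewrite !nth_cat sc il.
  have -> : (i.+1 %% l = (i %% l).+1 %% l)%N by rewrite -addn1 -modnDml addn1.
  have [il1|] := ltnP (i %% l).+1 l; first by rewrite (modn_small il1).
  move=> li; have e : ((i %% l).+1 = l)%N by lia.
  by rewrite e modnn subnn; apply.
have -> : seg (fun i => nth x0 c (i %% l)) 0 l = c.
  rewrite -[RHS](mkseq_nth x0) /mkseq sc /seg; apply/eq_in_map => i.
  by rewrite mem_iota => /andP[_ il]; rewrite modn_small.
by rewrite vc conjgE mulVKg.
Qed.

Lemma edge_at_sides R R2 lab o j (e e' : edge n F) (s1 s2 : bool) :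
  intersection_square R R2 e e' -> edge_at R lab o j e ->
  exists g, side R (vertex R lab o j) (lab j) g = s1 /\ side R2 e'.1 (e'.2, false) g = s2.
Proof.
move=> sq [] [ev el].
  have [g [h1 h2]] := intersection_square_points s1 s2 sq.
  by exists g; rewrite -ev -el.
have [g [h1 h2]] := intersection_square_points (~~ s1) s2 sq; exists g; split=> //.
apply: negb_inj; rewrite -h1 el ev vertexS side_flip //.
Qed.

Lemma reduced_inv_cat u y v : reduced u -> reduced (y :: v) -> ohead u != Some y ->
  reduced (inv_word u ++ y :: v).
Proof.
case: u => // z u ru rv zy; rewrite inv_word_cons reduced_cat_rcons_cons.
rewrite -inv_word_cons reduced_inv ru rv /= /compat inv_letterK.
by apply: contra zy => /eqP->.
Qed.

(** Take the edges of [E] that come first and last along the axis, and let [D]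
    consist of the pairs [(X, Y)] with [X] behind the first edge, [Y] in front of
    the last one, and both on the same side of [e']. The geodesic from [X] to [Y]
    then contains the stretch between the two edges, of length at least [k l]. *)
Lemma square_overlap R R2 w l k (e' : edge n F) (E : seq (edge n F)) : 
  (0 < l)%N -> (forall g, (l <= size (rword R (w ^ g)%g))%N) ->
  uniq E -> (forall e, e \in E -> axial R w l e /\ intersection_square R R2 e e') ->
  (0 < k)%N -> (k * l <= size E)%N ->
  exists D, overlap R w k D /\ separated D R2 e'.1 (e'.2, false).
Proof.
move=> l0 lmin uE hE k0 klE.
have E0 : E != [::].
  by rewrite -size_eq0 -lt0n (leq_trans _ klE) // muln_gt0 k0.
have [e eE] : exists e, e \in E by case: (E) E0 => // e E' _; exists e; exact: mem_head.
have se : size (rword R (w ^ e.1)%g) = l.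
  by apply/eqP; rewrite eqn_leq lmin andbT; have [[]] := hE e eE.
have [lab [lab_per lab_compat w_e]] := cyclic_line l0 lmin se.
have [z w_z hpos] := line_through l0 lab_per lab_compat w_e (fun e eE => (hE e eE).1).
have /choice[f hf] : forall e1, exists j, e1 \in E -> edge_at R lab z j e1.
  by move=> e1; have [/hpos[j hj]|] := boolP (e1 \in E); [exists j|exists 0%N].
have finj : {in E &, injective f}.
  by move=> e1 e2 /hf h1 /hf h2 ef; rewrite ef in h1; exact: edge_at_inj h1 h2.
have [e0 [e1 [e0E e1E fE]]] := extreme_elements uE finj E0.
have jj : (f e0 + k * l <= (f e1).+1)%N by apply: leq_trans fE; rewrite leq_add2l.
move: (f e0) (f e1) (hf _ e0E) (hf _ e1E) jj => j0 j1 at0 at1 jj.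
set o' := e'.1; set x' := (e'.2, false); pose V := vertex R lab z.
have sq0 := fun s1 s2 => edge_at_sides s1 s2 (hE _ e0E).2 at0.
have sq1 := fun s1 s2 => edge_at_sides s1 s2 (hE _ e1E).2 at1.
pose D X Y := [/\ side R (V j0) (lab j0) X = false, side R (V j1) (lab j1) Y = true &
   side R2 o' x' X = side R2 o' x' Y].
exists D; split; last first.
  move=> s; have [X [hX sX]] := sq0 false s; have [Y [hY sY]] := sq1 true s.
  by exists X, Y; split=> //; split=> //; rewrite sX sY.
exists (V j0), (seg lab j0 l); split.
- exact: seg_cyc.
- by rewrite (conj_vertex lab_per w_z).
move=> X Y [sX sY _].
have kl0 : (0 < k * l)%N by rewrite muln_gt0 k0.
have jle : (j0 <= j1)%N by rewrite -ltnS; apply: leq_trans jj; rewrite -addn1 leq_add2l.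
pose t := behead (rword R ((V j1)^-1 * Y)%g).
have et : rword R ((V j1)^-1 * Y)%g = lab j1 :: t.
  by move: sY; rewrite /t /side; case: (rword R _) => //= y u /eqP[->].
pose Q := seg lab (j0 + k * l) (j1.+1 - (j0 + k * l)) ++ t.
have eQ : word_pow k (seg lab j0 l) ++ Q = seg lab j0 (j1 - j0) ++ lab j1 :: t.
  rewrite -seg_pow // catA -segD -cat_rcons; congr (_ ++ t).
  rewrite -cats1; have -> : [:: lab j1] = seg lab (j0 + (j1 - j0)) 1 by rewrite subnKC.
  by rewrite -segD; congr seg; lia.
exists (inv_word (rword R ((V j0)^-1 * X)%g)), Q; rewrite eQ.
have vP : word_val R (inv_word (rword R ((V j0)^-1 * X)%g)) = (X^-1 * V j0)%g.
  by rewrite word_val_inv rword_val invgM invgK.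
split=> //; last first.
  rewrite word_val_cat vP word_val_cat -et rword_val -mulgA.
  by rewrite [(V j0 * _)%g]mulgA -vertexD subnKC // mulVKg.
have r1 : reduced (seg lab j0 (j1 - j0) ++ lab j1 :: t).
  rewrite -cat1s; apply: reduced_glue => //; last by rewrite cat1s -et rword_reduced.
  have -> : [:: lab j1] = seg lab (j0 + (j1 - j0)) 1 by rewrite subnKC.
  by rewrite -segD seg_reduced.
have [u eu] : exists u, seg lab j0 (j1 - j0) ++ lab j1 :: t = lab j0 :: u.
  move: jle; rewrite leq_eqVlt => /orP[/eqP->|j01]; first by rewrite subnn; exists t.
  by rewrite -[(j1 - j0)%N]prednK ?subn_gt0 //; eexists; rewrite /seg /=.
rewrite eu in r1 *; apply: reduced_inv_cat => //; first exact: rword_reduced.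
by move: sX; rewrite /side => /negbT.
Qed.

Section Loops.
Variables (alpha : set F) (alpha_loop : is_loop alpha).

Lemma loop_conj w1 w2 : alpha w1 -> alpha w2 -> exists g, w2 = (w1 ^ g)%g.
Proof.
case: alpha_loop => w _ -> [g1 _ <-] [g2 _ <-]; exists (g1^-1 * g2)%g.
by rewrite conjgM conjgK.
Qed.

Lemma loop_neq1 w : alpha w -> w <> 1%g.
Proof.
by case: alpha_loop => w0 w01 -> [g _ <-] /eqP; rewrite conjg_eq1 => /eqP.
Qed.

Lemma translation_length_le R w g : (translation_length R w <= size (rword R (w ^ g)%g))%N.
Proof.
have h : [set tree_dist R v (w * v)%g | v in [set: F]]%classic (tree_dist R g (w * g)%g).
  by exists g.
by have [_ /(_ _ h)] := nat_minP h; rewrite tree_distE conjgE.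
Qed.

Lemma translation_length_attained R w :
  exists g, translation_length R w = size (rword R (w ^ g)%g).
Proof.
have h : [set tree_dist R v (w * v)%g | v in [set: F]]%classic (tree_dist R 1%g (w * 1)%g).
  by exists 1%g.
have [[g _ hg] _] := nat_minP h; exists g.
by rewrite /translation_length -hg tree_distE conjgE.
Qed.

(** All the elements of a loop have the same translation length, as the axis is
    translated by conjugation. *)
Lemma loop_lengthE R w : alpha w -> loop_length R alpha = translation_length R w.
Proof.
move=> aw; apply: nat_min_eq; first by exists w.
move=> _ [w' aw' <-]; have [g ->] := translation_length_attained R w'.
have [h ->] := loop_conj aw aw'; rewrite -conjgM; exact: translation_length_le.
Qed.

Lemma loop_length_gt0 R : (0 < loop_length R alpha)%N.
Proof.
case: (alpha_loop) => w w1 ea; have aw : alpha w.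
  by rewrite ea; exists 1%g; rewrite ?conjg1.
rewrite (loop_lengthE R aw); have [g ->] := translation_length_attained R w.
rewrite lt0n size_eq0; apply/eqP => /(congr1 (word_val R)).
rewrite rword_val word_val_nil => /eqP; rewrite conjg_eq1 => /eqP; exact: w1.
Qed.

Lemma loop_length_le R w c g : alpha w -> word_val R c = (w ^ g)%g ->
  (loop_length R alpha <= size c)%N.
Proof.
move=> aw vc; rewrite (loop_lengthE R aw) (leq_trans (translation_length_le R w g)) //.
by rewrite -vc size_rword_le.
Qed.

Lemma card_slice_overlap R R2 w k (e' : edge n F) : alpha w -> (0 < k)%N ->
  (k * loop_length R alpha <= #|` fset_set (axis R w `&` slice R R2 e')%classic|)%N ->
  exists D, overlap R w k D /\ separated D R2 e'.1 (e'.2, false).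
Proof.
move=> aw k0 hk; set A := (axis R w `&` slice R R2 e')%classic in hk.
have l0 := loop_length_gt0 R.
have finA : finite_set A.
  apply: contrapT => infA; move: hk; rewrite /fset_set; case: pselect => // _.
  by rewrite cardfs0 leqNgt muln_gt0 k0 l0.
apply: (square_overlap l0 _ (fset_uniq (fset_set A)) _ k0 hk).
  by move=> g; rewrite (loop_lengthE R aw) translation_length_le.
move=> e; rewrite (in_fset_set finA) => /set_mem[[]]; rewrite /on_axis => h1 h2 h3.
split=> //.
by rewrite /axial (loop_lengthE R aw) -{1}h1 -h2 !tree_distE !conjgE.
Qed.

(** The ratios have the common denominator [l], so if none reached [k] they would
    all be at most [k - 1 / l], and so would their supremum. *)
Lemma twist_card (K : realType) R R2 k : (0 < k)%N ->
  (k%:R <= twist K alpha R R2)%R ->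
  exists w e', alpha w /\
  (k * loop_length R alpha <= #|` fset_set (axis R w `&` slice R R2 e')%classic|)%N.
Proof.
move=> k0 hk; apply: contrapT => no.
have l0 := loop_length_gt0 R; set l := loop_length R alpha in l0 no.
have lK : (0 < l%:R :> K)%R by rewrite ltr0n.
move: hk; rewrite /twist; set S := [set x | _]%classic.
suff : (sup S <= k%:R - l%:R^-1)%R.
  move=> h1 h2; have := le_trans h2 h1.
  by rewrite lerBrDr gerDl leNgt invr_gt0 lK.
have lk : (l%:R^-1 <= k%:R :> K)%R.
  by rewrite (le_trans (_ : _ <= 1)%R) ?ler1n // invf_le1 // ler1n.
have [->|/set0P S0] := eqVneq S set0; first by rewrite sup0 subr_ge0.
apply: ge_sup => // _ [e' [w [aw ->]]].
rewrite -/l ler_pdivrMr // mulrBl mulVf ?gt_eqF // -natrM lerBrDr natr1 ler_nat.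
rewrite ltnNge; apply/negP => h; apply: no; by exists w, e'.
Qed.

End Loops.
End Twisting.

Local Open Scope ring_scope.

Theorem theoremB (K : realType) (n : nat) (F : groupType)
  (F_free : free_of_rank n F)
  (m : nat) (Rs : nat -> labeled_rose n F)
  (Rs_fold : folding_sequence m Rs)
  (alpha : set F) (alpha_loop : is_loop alpha) :
  (tw K alpha (Rs 0%N) (Rs m) <= m%:Z) /\
  (forall L : K, 50 < L ->
     (forall i : nat, (i <= m)%N -> L <= (loop_length (Rs i) alpha)%:R) ->
     (tw K alpha (Rs 0%N) (Rs m))%:~R * log5 (L / 50) <= m%:R).
Proof.
have hx (L : K) : 50 < L -> 0 < log5 (L / 50).
  by move=> L50; rewrite divr_gt0 ?ln_gt0 ?ltr1n // ltr_pdivlMr // mul1r.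
have trivial_case (z : int) : z <= 0 -> z <= m%:Z /\ (forall L : K, 50 < L ->
    (forall i : nat, (i <= m)%N -> L <= (loop_length (Rs i) alpha)%:R) ->
    z%:~R * log5 (L / 50) <= m%:R).
  move=> z0; split=> [|L L50 _]; first exact: le_trans z0 _.
  rewrite (le_trans (_ : _ <= 0)) // mulr_le0_ge0 ?ler_wpDl //.
    by rewrite lerz0.
  by rewrite ltW // hx.
have := floor_le (twist K alpha (Rs 0%N) (Rs m)).
rewrite /tw; case: (Num.floor _) => [[|k]|k] hk; [exact: trivial_case| |exact: trivial_case].
have [w [e' [aw hcard]]] := twist_card alpha_loop (ltn0Sn k) hk.
have [D [ov sep]] := card_slice_overlap alpha_loop aw (ltn0Sn k) hcard.
have w1 := loop_neq1 alpha_loop aw.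
split=> [|L L50 hL]; first by rewrite lez_nat ltnW // (overlap_lt Rs_fold w1 sep ov).
set x := log5 (L / 50); have x0 : 0 < x by exact: hx.
pose q := Num.truncn x.
(* With [5 ^ q <= L / 50] one has [4 * 2 ^ q <= 4 * L / 50 <= L]. *)
have pow_le : (2 ^ q.+1).-1.*2%:R <= L.
  have q5 : 5 ^+ q <= L / 50.
    rewrite -ler_ln ?posrE ?exprn_gt0 ?divr_gt0 ?(lt_trans _ L50) // lnXn //.
    have : q%:R <= x by rewrite truncn_le ltW.
    by rewrite /x /log5 ler_pdivlMr ?ln_gt0 ?ltr1n // mulr_natl.
  have q2 : 2 ^+ q <= 5 ^+ q :> K by rewrite lerXn2r ?nnegrE ?ler_nat.
  rewrite (le_trans (_ : _ <= (2 ^ q.+1).*2%:R)) ?ler_nat ?leq_double ?leq_pred //.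
  rewrite -muln2 expnS !natrM natrX.
  move: q2 q5; move: (2 ^+ q) (5 ^+ q) => a b; lra.
have := overlap_mul_le Rs_fold w1 (p := q.+1) _ sep ov.
rewrite -(ler_nat K) natrM => hm; apply: le_trans (hm _) => [|i c g im vc].
  by rewrite ler_wpM2l // ltW // truncnS_gt.
rewrite -(ler_nat K) (le_trans pow_le) // (le_trans (hL i im)) // ler_nat.
exact: (loop_length_le alpha_loop aw vc).
Qed.
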